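(* Let $\mu$ be a directed distance on $S$. (1) If $\dim T_\mu\ge2$, then there is no positive integer $k$ such that for every network $(G,S,c)$ the $\mu$-weighted maximum multiflow problem has a $1/k$-integral optimal multiflow. (2) If $\dim\bar Q^{slim}_\mu\ge2$, then there is no positive integer $k$ such that for every totally Eulerian network $(G,S,c)$ the $\mu$-weighted maximum multiflow problem has a $1/k$-integral optimal multiflow.
   Context: A network $(G,S,c)$: finite digraph $G=(VG,EG)$, terminals $S\subseteq VG$, capacity $c:EG\to\mathbb Z_+$. A multiflow is a set $\mathcal P$ of directed paths joining distinct terminals with $\lambda:\mathcal P\to\mathbb R_+$, $\sum_{P\ni e}\lambda(P)\le c(e)$; it is $1/k$-integral if $k\lambda$ is integer-valued. A directed distance is $\mu:S\times S\to\mathbb R_+$ with zero diagonal; the $\mu$-weighted maximum multiflow problem maximizes $\sum_P\lambda(P)\mu(s_P,t_P)$ ($s_P,t_P$ start and end). The network is totally Eulerian if at every node the outgoing capacity equals the incoming capacity. Let $S^c,S^r$ be disjoint copies of $S$ ($s^c,s^r$; $X^c,X^r$), $S^{cr}=S^c\cup S^r$. $P_\mu=\{p\in\mathbb R^{S^{cr}}:p(s^c)+p(t^r)\ge\mu(s,t)\ \forall s,t\}$; $T_\mu$ = minimal points (coordinatewise order) of the set of nonnegative points of $P_\mu$; $Q_\mu$ = minimal points of $P_\mu$. $\dim T_\mu$ is the largest dimension of a face of $P_\mu$ contained in $T_\mu$. $L=\mathbb R(\mathbf 1,-\mathbf 1)$. For $p\in Q_\mu$, $K(p)$ is the bipartite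 graph on $S^{cr}$ with edges $s^ct^r$ where $p(s^c)+p(t^r)=\mu(s,t)$; $N_p(U)$ = nodes outside $U$ adjacent to $U$. $\mathcal S_0$ = family of $X\subseteq S$ with $\mu(s,t)=0$ for $s,t\in X$. For $X\in\mathcal S_0$: $Q_{\mu,X}$ = points $p\in Q_\mu$ with ($s^cs^r\in EK(p)\iff s\in X$); $p$ is a fat relative to $X$ if $p\in Q_{\mu,X}$ and $N_p(S^c\setminus X^c)\subseteq S^r\setminus X^r$ or $N_p(S^r\setminus X^r)\subseteq S^c\setminus X^c$; $Q^{deg}_{\mu,X}$ = points of $Q_{\mu,X}$ with one of these an equality. Proper fat: fat in no degenerate set. $Q^{slim}_\mu$ = $Q_\mu$ minus proper fats; $p\sim q$ on it if $p-q\in L$ or both lie in some $Q^{deg}_{\mu,X}$ with $p-q\in L+\mathbb R(\mathbf 1_{X^c},-\mathbf 1_{X^r})$; $\bar Q^{slim}_\mu=Q^{slim}_\mu/\sim$; $\dim\bar Q^{slim}_\mu$ is the largest dimension of faces of $Q^{slim}_\mu$ taken modulo $\sim$. *)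

(* Defs.v *)
From mathcomp Require Import all_boot all_order all_algebra.
From mathcomp Require Import finmap.
From mathcomp Require Import boolp classical_sets reals.

Set Implicit Arguments.
Unset Strict Implicit.
Unset Printing Implicit Defensive.

Import Order.TTheory GRing.Theory Num.Theory.

Local Open Scope classical_set_scope.
Local Open Scope ring_scope.

(** * Networks and multiflows *)

(* Only the values of [cap] on edges matter. *)
Record network (S : finType) := Network {
  vert : finType;
  edge : rel vert;
  cap : vert -> vert -> nat;
  term : S -> vert;
  term_inj : injective term
}.

Section Multiflows.
Variables (R : realType) (S : finType) (mu : S -> S -> R) (N : network S).

Definition directed_distance : Prop :=
  (forall s t, 0 <= mu s t) /\ (forall s, mu s s = 0).

Definition totally_eulerian : Prop :=
  forall x : vert N,
    (\sum_(y | edge x y) cap x y = \sum_(y | edge y x) cap y x)%N.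

(* A path is the sequence of its (pairwise distinct) vertices. *)
Definition joins (s t : S) (p : seq (vert N)) : bool :=
  if p is x :: q then
    [&& x == term N s, last x q == term N t, path (@edge S N) x q & uniq p]
  else false.

Definition terminal_path (p : seq (vert N)) : Prop :=
  exists s t : S, s != t /\ joins s t p.

Definition traverses (p : seq (vert N)) (x y : vert N) : bool :=
  (x, y) \in zip p (behead p).

Definition multiflow (P : {fset seq (vert N)}) (lam : seq (vert N) -> R) : Prop :=
  [/\ forall p, p \in P -> terminal_path p,
      forall p, p \in P -> 0 <= lam p
    & forall x y, edge x y ->
        \sum_(p <- P | traverses p x y) lam p <= (cap x y)%:R].

(* [term] is injective, so the inner sum has exactly one term when [p] is a
   terminal path. *)
Definition mu_value (P : {fset seq (vert N)}) (lam : seq (vert N) -> R) : R :=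
  \sum_(p <- P) lam p * \sum_(st : S * S | joins st.1 st.2 p) mu st.1 st.2.

Definition optimal_multiflow (P : {fset seq (vert N)})
    (lam : seq (vert N) -> R) : Prop :=
  multiflow P lam /\
  forall P' lam', multiflow P' lam' -> mu_value P' lam' <= mu_value P lam.

Definition fractionally_integral (k : nat) (P : {fset seq (vert N)})
    (lam : seq (vert N) -> R) : Prop :=
  forall p, p \in P -> k%:R * lam p \is a Num.int.

Definition has_integral_optimum (k : nat) : Prop :=
  exists (P : {fset seq (vert N)}) (lam : seq (vert N) -> R),
    optimal_multiflow P lam /\ fractionally_integral k P lam.

End Multiflows.

(** * Polyhedra *)

Section Polyhedra.
Variables (R : realType) (I : finType).
Local Notation point := {ffun I -> R^o}.

Definition is_minimal (A : set point) (p : point) : Prop :=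
  A p /\ forall q, A q -> (forall i, q i <= p i) -> q = p.

Definition is_face (A F : set point) : Prop :=
  F !=set0 /\
  exists (c : point) (b : R),
    (forall p, A p -> b <= \sum_i c i * p i) /\
    F = [set p | A p /\ \sum_i c i * p i = b].

Definition has_affine_free (A : set point) (d : nat) : Prop :=
  exists (p0 : point) (u : d.-tuple point),
    [/\ A p0, forall i, A (p0 + tnth u i) & free u].

(* Dimension of the affine hull; 0 for the empty set. *)
Definition affdim (A : set point) : nat :=
  \max_(d < #|I|.+1 | `[< has_affine_free A d >]) d.

(* Relative interior of a convex set. *)
Definition relint (F : set point) : set point :=
  [set p | F p /\
     forall q, F q -> exists2 e : R, 0 < e & F (p + e *: (p - q))].

End Polyhedra.

(** * The polyhedra attached to a directed distance *)

Section TightSpan.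
Variables (R : realType) (S : finType) (mu : S -> S -> R).

(* [inl s] is s^c and [inr s] is s^r. *)
Local Notation point := {ffun S + S -> R^o}.

Definition Pmu : set point :=
  [set p | forall s t, mu s t <= p (inl s) + p (inr t)].

Definition Pmu_nonneg : set point :=
  [set p | Pmu p /\ forall v, 0 <= p v].

Definition Tmu : set point := [set p | is_minimal Pmu_nonneg p].

Definition Qmu : set point := [set p | is_minimal Pmu p].

(* Tmu is a union of faces of Pmu_nonneg. Faces of Pmu itself would not do:
   each of them is invariant under the line spanned by (1, -1), so none is
   contained in the nonnegative orthant unless S is empty. *)
Definition dim_Tmu : nat :=
  \max_(d < #|{: S + S}|.+1 |
        `[< exists F, [/\ is_face Pmu_nonneg F, F `<=` Tmu & affdim F = d] >]) d.

Definition Kadj (p : point) (u v : S + S) : bool :=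
  match u, v with
  | inl s, inr t | inr t, inl s => p (inl s) + p (inr t) == mu s t
  | _, _ => false
  end.

Definition nbhd (p : point) (U : {set S + S}) : {set S + S} :=
  [set v | (v \notin U) && [exists u in U, Kadj p u v]]%SET.

Definition ccopy (X : {set S}) : {set S + S} := [set inl s | s in X]%SET.
Definition rcopy (X : {set S}) : {set S + S} := [set inr s | s in X]%SET.

Definition zero_family (X : {set S}) : Prop :=
  forall s t, s \in X -> t \in X -> mu s t = 0.

Definition QmuX (X : {set S}) : set point :=
  [set p | Qmu p /\ forall s, Kadj p (inl s) (inr s) = (s \in X)].

Definition fat_rel (X : {set S}) (p : point) : Prop :=
  QmuX X p /\
  ((nbhd p (ccopy (~: X)) \subset rcopy (~: X)) \/
   (nbhd p (rcopy (~: X)) \subset ccopy (~: X))).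

Definition Qdeg (X : {set S}) : set point :=
  [set p | QmuX X p /\
     (nbhd p (ccopy (~: X)) = rcopy (~: X) \/
      nbhd p (rcopy (~: X)) = ccopy (~: X))].

Definition proper_fat (p : point) : Prop :=
  (exists X, zero_family X /\ fat_rel X p) /\ ~ (exists X, zero_family X /\ Qdeg X p).

Definition Qslim : set point := [set p | Qmu p /\ ~ proper_fat p].

(* (1_{X^c}, -1_{X^r}) *)
Definition shift (X : {set S}) : point :=
  [ffun v => match v with
             | inl s => (s \in X)%:R
             | inr s => - (s \in X)%:R
             end].

Definition slim_equiv (p q : point) : Prop :=
  (exists a : R, p - q = a *: shift [set: S]%SET) \/
  (exists X, [/\ zero_family X, Qdeg X p, Qdeg X q
     & exists a b : R, p - q = a *: shift [set: S]%SET + b *: shift X]).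

(* Dimension of F modulo slim_equiv: dim F minus the dimension of the class of
   a generic point. The point must be in the relative interior, because a
   boundary point of F may lie in a degenerate set, and so have a larger class,
   although generic points of F do not. Kadj is constant on the relative
   interior, so the value does not depend on p. *)
Definition quotient_dim (F : set point) (d : nat) : Prop :=
  exists p, relint F p /\
    d = (affdim F - affdim [set q | F q /\ slim_equiv q p])%N.

Definition dim_Qslim_bar : nat :=
  \max_(d < #|{: S + S}|.+1 |
        `[< exists F, [/\ is_face Pmu F, F `<=` Qslim & quotient_dim F d] >]) d.

End TightSpan.

(* Main.v *)
Require Import Defs.
From HB Require Import structures.
From mathcomp Require Import all_boot all_order all_algebra.
From mathcomp Require Import finmap.
From mathcomp Require Import boolp classical_sets reals.
From mathcomp Require Import zify ring lra.

Set Implicit Arguments.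
Unset Strict Implicit.
Unset Printing Implicit Defensive.

Import Order.TTheory GRing.Theory Num.Theory.

Local Open Scope ring_scope.

(* An integral optimum is excluded by a directed two-commodity flow problem.  An
   interior point p of a two-dimensional face of T_mu provides two tight pairs
   (s2, t2) and (s3, t3) such that neither (s2, t3) nor (s3, t2) is tight.  Attach
   these terminals to a core all of whose vertices receive the potential p.  By
   complementary slackness an optimal multiflow saturates the arcs at the
   terminals and sends through the core only flow from s2 to t2 and from s3 to
   t3.  The core has k + 1 lanes, and the competition of the two commodities for
   arcs of capacity one forces the flow to be equal in all lanes, namely
   1 / (k + 1); hence it is not 1/k-integral.

   In the totally Eulerian case a third commodity absorbs the imbalance of the
   core, and the terminals are balanced by direct arcs carrying a circulation
   supported by tight pairs.  Such a circulation exists after perturbing p: the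
   loops of the tight graph can be destroyed while every vertex keeps tight
   partners, because p is degenerate or not fat, and further perturbation makes
   the tight graph a disjoint union of at least three complete bipartite graphs.
   Then each s in S is an arc from the component of s^r to the component of s^c,
   in a digraph without loops, sources and sinks, and the cycles of such a
   digraph meet at least three vertices. *)

(** * Circulations in digraphs *)

(** The potentials [c] and [r] act as a dual solution: they price the arcs that leave and enter
    terminals. An explicit fractional multiflow attains the priced capacity, so every optimum obeys
    complementary slackness. This also has to keep optimal paths from passing through terminals, and
    here loops are the obstacle: a terminal s with [c s + r s = 0] is traversed for free, and
    commodities could mix there. In the first part such sums disappear by raising all potentials off
    the chosen pairs. In the Eulerian part raising is too crude, since the direct arcs at the
    terminals must themselves be tight; loops have to be broken without leaving any vertex that is
    kept bare of tight partners. Vertices dropped on the way are given large potentials at the end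
    and carry no direct arcs. Three separated rows are needed there, hence three independent
    directions of the face. Two come from the quotient dimension; the third comes from the line
    spanned by (1, -1), a direction of every face of [Pmu] that the quotient forgets. The
    commodities that saturate the core must have positive value, since a pair of value zero may have
    both potentials zero and then prices no arc; the third commodity may have value zero. *)

Section Circulations.
Variables (T : finType) (e : rel T).

Definition balanced (w : T -> T -> nat) : Prop :=
  forall s, (\sum_t w s t = \sum_t w t s)%N.

(** One unit is sent along a path. Arcs are counted with multiplicity, so the path need not be
    simple. *)
Lemma connect_flow (x y : T) : connect e x y ->
  exists w : T -> T -> nat, (forall s t, (0 < w s t)%N -> e s t) /\
    forall s, (\sum_t w s t + (s == y) = \sum_t w t s + (s == x))%N.
Proof.
case/connectP=> q; elim: q x => [|z q IHq] x /=.
  by move=> _ ->; exists (fun _ _ => 0%N); split=> // s; rewrite !big1.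
case/andP=> exz /IHq {}IHq /IHq [w [we wE]].
exists (fun s t => (w s t + (s == x) * (t == z))%N); split=> [s t|s].
  case: (eqVneq s x) => [->|_]; case: (eqVneq t z) => [->|_] //=;
    by rewrite ?muln0 ?mul0n ?addn0; apply: we.
have inj1 (b : bool) (u : T) : (\sum_t b * (t == u) = b)%N.
  rewrite (bigD1 u) //= eqxx big1 ?addn0 ?muln1 // => t /negbTE ->.
  by rewrite muln0.
rewrite !big_split /= inj1.
under [X in (_ = _ + X + _)%N]eq_bigr do rewrite mulnC.
by rewrite inj1; move: (wE s); lia.
Qed.

Lemma cycle_circulation (x y : T) : e x y -> connect e y x ->
  exists w : T -> T -> nat,
    [/\ forall s t, (0 < w s t)%N -> e s t, balanced w & (0 < w x y)%N].
Proof.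
move=> exy /connect_flow [w [we wE]].
exists (fun s t => (w s t + (s == x) * (t == y))%N); split=> [s t|s|].
- case: (eqVneq s x) => [->|_]; case: (eqVneq t y) => [->|_] //=;
    by rewrite ?muln0 ?mul0n ?addn0; apply: we.
- have inj1 (b : bool) (u : T) : (\sum_t b * (t == u) = b)%N.
    rewrite (bigD1 u) //= eqxx big1 ?addn0 ?muln1 // => t /negbTE ->.
    by rewrite muln0.
  rewrite !big_split /= inj1.
  under [X in (_ = _ + X)%N]eq_bigr do rewrite mulnC.
  by rewrite inj1; move: (wE s); lia.
- by rewrite !eqxx addn1.
Qed.

(** A closed walk through [s] is enough, because circulations may use an arc repeatedly. *)
Definition on_cycle (s : T) : bool := [exists t, e s t && connect e t s].

Lemma on_cycle_connect (s z y : T) :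
  connect e s z -> e z y -> connect e y s -> on_cycle s.
Proof.
move=> /connectP [[|s' q] /= + ->] ezy ys; first by move=> _; apply/existsP; exists y; rewrite ezy.
case/andP=> ess' qP; apply/existsP; exists s'; rewrite ess' /=.
have s'l : connect e s' (last s' q) by apply/connectP; exists q.
by apply: connect_trans s'l (connect_trans (connect1 ezy) ys).
Qed.

End Circulations.

(* A vertex minimizing the size of its reachable set lies on a cycle. *)
Lemma reach_cycle (T : finType) (e : rel T) (s : T) :
  (forall t, connect e s t -> exists u, e t u) ->
  exists2 z, connect e s z & on_cycle e z.
Proof.
move=> succ.
have [z sz zmin] := @arg_minnP _ s (connect e s) (fun t => #|connect e t|) (connect0 e s).
exists z => //; have [u ezu] := succ _ sz; apply/existsP; exists u; rewrite ezu /=.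
have su : connect e s u := connect_trans sz (connect1 ezu).
have sub : connect e u \subset connect e z.
  by apply/fintype.subsetP=> t; rewrite !inE; apply: connect_trans; apply: connect1.
have /subset_leqif_card/geq_leqif := sub; rewrite zmin // => /esym subz.
exact: (fintype.subsetP subz) (connect0 e z).
Qed.

Section ThreeClasses.
Variables (T : finType) (e : rel T) (U : {set T}).
Hypotheses (eU : forall s t, e s t -> (s \in U) && (t \in U))
  (succ : forall s, s \in U -> exists t, e s t)
  (pred : forall s, s \in U -> exists t, e t s)
  (irr : forall s, ~~ e s s)
  (rect : forall s t s' t', e s t -> e s' t -> e s' t' -> e s t').

(** For rows with successors in a relation satisfying [rect], this means different complete
    bipartite components. It passes to subrelations, so it survives every perturbation that only
    destroys tight pairs. *)
Definition apart (s t : T) : Prop := forall u, e s u -> ~~ e t u.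

Lemma apart_sym s t : apart s t -> apart t s.
Proof. by move=> st u tu; apply/negP=> /st; rewrite tu. Qed.

Lemma reach_in s t : s \in U -> connect e s t -> t \in U.
Proof.
move=> sU /connectP [q + ->]; elim: q s sU => //= z q IHq s sU /andP [/eU/andP[_ zU]].
exact: IHq.
Qed.

(* If x lies on no cycle, then a cycle vertex reached from x, a cycle vertex
   reaching x and the successor of the latter on its cycle are pairwise apart. *)
Lemma apart_on_cycle (s : 'I_3 -> T) :
    (forall i, s i \in U) -> (forall i j, i != j -> apart (s i) (s j)) ->
  exists z : 'I_3 -> T, (forall i, on_cycle e (z i)) /\
    (forall i j, i != j -> apart (z i) (z j)).
Proof.
move=> sU sA; have [Zs|] := boolP [forall i, on_cycle e (s i)].
  by exists s; split=> // i; move/forallP: Zs.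
case/forallPn=> i0 nZ; move: (sU i0) nZ; move: (s i0) => x xU nZ.
have [z xz Zz] : exists2 z, connect e x z & on_cycle e z.
  by apply: reach_cycle => t /(reach_in xU); apply: succ.
have [z0 z0x Zz0] : exists2 z, connect e z x & on_cycle e z.
  have rev (a b : T) : connect [rel u v | e v u] a b = connect e b a.
    exact: (connect_rev e).
  have [t|z2] := @reach_cycle _ [rel u v | e v u] x.
    rewrite rev => /connectP [[|y q] /= + xE]; first by move=> _; rewrite -xE; apply: pred.
    case/andP=> ety _; apply: pred; by have /andP [] := eU ety.
  rewrite rev => zx /existsP [t /andP[/= etz]]; rewrite rev => zt.
  by exists z2 => //; apply: (on_cycle_connect zt etz).
case/existsP: Zz0 => z1 /andP [e01 z10].
have z01 : z0 != z1 by apply: contraL e01 => /eqP <-.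
(* With the arc from z0 to z1, a common successor would produce a loop at z1 by rectangularity. *)
have a01 : apart z0 z1.
  move=> u e0u; apply/negP=> e1u; have := irr z1.
  by rewrite (rect e1u e0u e01).
(* A common successor would give an arc from z to a vertex that reaches x, which closes a walk
   through x; the same idea serves for z1. *)
have az0 : apart z z0.
  move=> u ezu; apply/negP=> e0u; case/negP: nZ.
  apply: (on_cycle_connect xz (rect ezu e0u e01)).
  exact: connect_trans z10 z0x.
have az1 : apart z z1.
  move=> u ezu; apply/negP=> e1u; case/negP: nZ.
  have [t0 e1t t0z] : exists2 t0, e z1 t0 & connect e t0 z0.
    case/connectP: z10 => [[|t0 q] /=]; first by move=> _ E; rewrite E eqxx in z01.
    by case/andP=> ? ? ?; exists t0 => //; apply/connectP; exists q.
  apply: (on_cycle_connect xz (rect ezu e1u e1t)).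
  exact: connect_trans t0z z0x.
have Zz0 : on_cycle e z0 by apply/existsP; exists z1; rewrite e01.
have Zz1 : on_cycle e z1 by apply: on_cycle_connect z10 e01 (connect0 _ _).
exists (tnth [tuple z; z0; z1]); split.
  by move=> i; rewrite (tnth_nth z); case: i => [[|[|[|]]]].
move=> i j; rewrite !(tnth_nth z).
by case: i => [[|[|[|]]]] // ?; case: j => [[|[|[|]]]] // ? //= _;
   apply: apart_sym.
Qed.

(** Take [y i] as the successor of [x i] on a closed walk and add the three circulations. An arc
    from [x i] to [y j] with i different from j is impossible, since [y j] is already a successor of
    [x j]. *)
Lemma three_class_circulation (s : 'I_3 -> T) :
    (forall i, s i \in U) -> (forall i j, i != j -> apart (s i) (s j)) ->
  exists (x y : 'I_3 -> T) (w : T -> T -> nat),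
    [/\ forall i j, e (x i) (y j) = (i == j),
        forall s t, (0 < w s t)%N -> e s t, balanced w
      & forall i, (0 < w (x i) (y i))%N].
Proof.
move=> sU sA; have [x [xZ xA]] := apart_on_cycle sU sA.
have /fin_all_exists [y /all_and2 [exy yx]] i : exists t, e (x i) t /\ connect e t (x i).
  by case/existsP: (xZ i) => t /andP[]; exists t.
have /fin_all_exists [w /all_and3 [we wb wp]] i := cycle_circulation (exy i) (yx i).
exists x, y, (fun s t => \sum_i w i s t)%N; split=> [i j|s' t|s'|i].
- case: eqVneq => [->|ij]; first exact: exy.
  by apply/negbTE; apply: xA (exy j); rewrite eq_sym.
- by rewrite lt0n sum_nat_eq0 => /forallPn [i]; rewrite -lt0n; apply: we.
- rewrite exchange_big [RHS]exchange_big /=.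
  by apply: eq_bigr => i _; apply: wb.
- by rewrite (bigD1 i) //= addn_gt0 wp.
Qed.

End ThreeClasses.

(** * Perturbation of potentials *)

Lemma positive_lower_bound (R : realDomainType) (I : finType) (P : pred I) (f : I -> R) :
  (forall i, P i -> 0 < f i) -> exists2 e, 0 < e & forall i, P i -> e <= f i.
Proof.
move=> f0; have [i0 Pi0|P0] := pickP P; last first.
  by exists 1 => // i; rewrite P0.
have [i Pi imin] := @arg_minP _ _ _ i0 P f Pi0.
by exists (f i) => //; apply: f0.
Qed.

Section Potentials.
Variables (R : realType) (S : finType) (m : S -> S -> R).

Definition feasible (U : {set S}) (c r : S -> R) : Prop :=
  forall s t, s \in U -> t \in U -> m s t <= c s + r t.

(** The bipartite tight graph is read as a digraph on S: the edge between row s (potential [c]) and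
    column t (potential [r]) is an arc from s to t, and the edge between the two copies of s is a
    loop. *)
Definition tight (U : {set S}) (c r : S -> R) (s t : S) : bool :=
  [&& s \in U, t \in U & c s + r t == m s t].

Definition covered (U : {set S}) (e : rel S) : Prop :=
  forall s, s \in U -> (exists t, e s t) /\ (exists t, e t s).

Lemma tight_in U c r s t : tight U c r s t -> (s \in U) && (t \in U).
Proof. by case/and3P=> -> ->. Qed.

(* The potential moves by a small amount: up on the columns of [N], down on the
   rows whose tight columns all belong to [N]. *)
Lemma break_tight (U N : {set S}) (c r : S -> R) : feasible U c r ->
  exists c' r', feasible U c' r' /\ forall s t,
    tight U c' r' s t = tight U c r s t &&
      ([forall u, tight U c r s u ==> (u \in N)] || (t \notin N)).
Proof.
move=> feas; pose M s := [forall u, tight U c r s u ==> (u \in N)].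
pose slack (p : S * S) := c p.1 + r p.2 - m p.1 p.2.
have [|e e0 eP] := @positive_lower_bound R _
    [pred p | [&& p.1 \in U, p.2 \in U & slack p != 0]] slack.
  case=> s t /= /and3P[sU tU]; rewrite lt_neqAle eq_sym => -> /=.
  by rewrite subr_ge0 feas.
(* Half of a lower bound for the positive slacks: pairs that are not tight stay strictly slack. *)
have e2 : 0 < e / 2 by rewrite divr_gt0.
have e2e : e / 2 < e by rewrite ltr_pdivrMr // mulr2n mulrDr mulr1 ltrDl.
exists (fun s => c s - (e / 2) *+ M s), (fun t => r t + (e / 2) *+ (t \in N)).
have key s t : s \in U -> t \in U ->
    0 <= slack (s, t) - (e / 2) *+ M s + (e / 2) *+ (t \in N) /\
    (slack (s, t) - (e / 2) *+ M s + (e / 2) *+ (t \in N) == 0) =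
      (slack (s, t) == 0) && (M s || (t \notin N)).
  move=> sU tU; have s0 : 0 <= slack (s, t) by rewrite subr_ge0 feas.
  have [sl0|sl0] := eqVneq (slack (s, t)) 0.
    rewrite sl0 sub0r; case Ms: (M s) => /=.
      have -> : t \in N.
        move/forallP/(_ t)/implyP: Ms; apply; rewrite /tight sU tU /=.
        by rewrite -subr_eq0 -/(slack (s,t)) sl0.
      by rewrite mulr1n addNr eqxx.
    case: (t \in N); rewrite /= ?mulr1n mulr0n oppr0 add0r ?eqxx //.
    by split; [apply: ltW | rewrite gt_eqF].
  have es : e <= slack (s, t) by apply: eP; rewrite /= sU tU.
  have : 0 < slack (s, t) - (e / 2) *+ M s + (e / 2) *+ (t \in N).
    by case: (M s); case: (t \in N); rewrite /= ?mulr1n ?mulr0n; lra.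
  by move=> lt0; split; [apply: ltW | rewrite gt_eqF].
have slE s t : c s - (e / 2) *+ M s + (r t + (e / 2) *+ (t \in N)) - m s t =
    slack (s, t) - (e / 2) *+ M s + (e / 2) *+ (t \in N).
  by rewrite /slack /=; ring.
split; [move=> s t sU tU | move=> s t]; first by rewrite -subr_ge0 slE; have [] := key s t sU tU.
rewrite -/(M s) /tight; case sU: (s \in U) => //=; case tU: (t \in U) => //=.
rewrite -subr_eq0 slE; have [_ ->] := key s t sU tU.
by rewrite /slack subr_eq0.
Qed.

(** A lowered row keeps all its tight pairs, and any other row has a tight column outside [N], which
    it keeps. Columns outside [N] lose nothing; for a column of [N] the hypothesis supplies a
    lowered row. *)
Lemma break_covered (U N : {set S}) (c r c' r' : S -> R) :
    covered U (tight U c r) ->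
    (forall t, t \in N -> exists2 s, tight U c r s t &
        forall u, tight U c r s u -> u \in N) ->
    (forall s t, tight U c' r' s t = tight U c r s t &&
      ([forall u, tight U c r s u ==> (u \in N)] || (t \notin N))) ->
  covered U (tight U c' r').
Proof.
move=> cov NM E s sU; have [[t st] [t' ts]] := cov s sU; split.
  case Ms: [forall u, tight U c r s u ==> (u \in N)].
    by exists t; rewrite E st Ms.
  move/negbT/forallPn: Ms => [u]; rewrite negb_imply => /andP[su uN].
  by exists u; rewrite E su uN orbT.
have [/NM [z zs zN]|sN] := boolP (s \in N); last by exists t'; rewrite E ts sN orbT.
exists z; rewrite E zs /=; apply/orP; left.
by apply/forallP=> u; apply/implyP/zN.
Qed.

(** Induction on the number of tight pairs. If (s, t), (s', t), (s', t') are tight but (s, t') is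
    not, breaking with [N] the tight columns of s destroys (s', t): the row s' is not lowered
    because of t'. *)
Lemma rectangular_potential (U : {set S}) (c r : S -> R) :
    feasible U c r -> covered U (tight U c r) ->
  exists c' r', [/\ feasible U c' r', covered U (tight U c' r'),
    (forall s t, tight U c' r' s t -> tight U c r s t) &
    (forall s t s' t', tight U c' r' s t -> tight U c' r' s' t ->
       tight U c' r' s' t' -> tight U c' r' s t')].
Proof.
have [n] := ubnP #|[set p : S * S | tight U c r p.1 p.2]|.
elim: n c r => // n IHn c r; rewrite ltnS => cn feas cov.
have [rect|] := pselect (forall s t s' t', tight U c r s t ->
    tight U c r s' t -> tight U c r s' t' -> tight U c r s t').
  by exists c, r; split.
move=> /existsNP [s /existsNP [t /existsNP [s' /existsNP [t' H]]]].
have [st s't s't' nst'] : [/\ tight U c r s t, tight U c r s' t,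
    tight U c r s' t' & ~~ tight U c r s t'].
  by move: H; do 3![move=> /not_implyP[? H]; move: H] => /negP ?.
pose N := [set u | tight U c r s u].
have [c' [r' [feas' E]]] := break_tight N feas.
have cov' : covered U (tight U c' r').
  apply: break_covered cov _ E => u; rewrite inE => su.
  by exists s => // v sv; rewrite inE.
have sub x y : tight U c' r' x y -> tight U c r x y by rewrite E => /andP[].
have [|||c2 [r2 [f2 cov2 sub2 rect2]]] := IHn c' r' => //.
  apply: leq_trans cn; apply: proper_card; apply/properP; split.
    by apply/fintype.subsetP=> p; rewrite !inE; apply: sub.
  exists (s', t); rewrite !inE //= E s't /=.
  have -> : t \in N by rewrite inE.
  rewrite orbF.
  by apply/negP=> /forallP/(_ t'); rewrite s't' inE (negbTE nst').
by exists c2, r2; split=> // x y /sub2/sub.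
Qed.

End Potentials.

(** * Destroying the loops of the tight graph *)

Section LoopDefs.
Variables (S : finType) (e : rel S).

Definition loopless : Prop := forall s, ~~ e s s.

(* Negation of fatness: the looped vertices exchange tight pairs with the
   loopless ones in both directions. *)
Definition two_way : Prop :=
  (exists a x, [/\ ~~ e a a, e x x & e a x]) /\
  (exists x b, [/\ e x x, ~~ e b b & e x b]).

Definition loops : {set S} := [set x | e x x].

End LoopDefs.

Lemma tight_restrict (R : realType) (S : finType) (m : S -> S -> R) (U V : {set S})
    (c r : S -> R) s t : V \subset U ->
  tight m V c r s t = [&& tight m U c r s t, s \in V & t \in V].
Proof.
move=> /fintype.subsetP VU; rewrite /tight; case sV: (s \in V); rewrite ?andbF //.
by case tV: (t \in V); rewrite ?andbF // (VU _ sV) (VU _ tV) !andbT.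
Qed.

Lemma tight_transpose (R : realType) (S : finType) (m : S -> S -> R) (U : {set S})
    (c r : S -> R) s t :
  tight (fun x y => m y x) U r c s t = tight m U c r t s.
Proof. by rewrite /tight andbCA addrC. Qed.

Section Unloop.
Variables (R : realType) (S : finType) (m : S -> S -> R).
Hypotheses (m_ge0 : forall s t, 0 <= m s t) (m_diag : forall s, m s s = 0).

(** The two loops have sum zero, so the two cross sums add up to zero, while each is bounded below
    by a nonnegative [m]. *)
Lemma loops_complete (U : {set S}) (c r : S -> R) x y : feasible m U c r ->
  tight m U c r x x -> tight m U c r y y -> tight m U c r x y.
Proof.
move=> feas /and3P[xU _ /eqP xx] /and3P[yU _ /eqP yy]; rewrite /tight xU yU /=.
move: xx yy; rewrite !m_diag => xx yy.
have h1 := feas _ _ xU yU; have h2 := feas _ _ yU xU.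
have h3 := m_ge0 x y; have h4 := m_ge0 y x.
apply/eqP; lra.
Qed.

(** With [N] the tight columns of [a], all of them loops, exactly the loops in [N] break, and pairs
    with a column outside [N] stay tight. Either no loop remains, or a surviving loop serves as
    partner of a vertex whose loop has just been broken. *)
Lemma unloop_step (U : {set S}) (c r : S -> R) (a : S)
    (e := tight m U c r) :
    feasible m U c r -> covered U e -> two_way e ->
    a \in U -> ~~ e a a -> (forall t, e a t -> e t t) ->
    (forall x b, e a x -> e x b -> e b b) \/
      (forall x, e x x -> exists2 b, e x b & ~~ e b b) ->
  exists c' r' (e' := tight m U c' r'),
    [/\ feasible m U c' r', covered U e', (forall s t, e' s t -> e s t),
        (#|loops e'| < #|loops e|)%N & two_way e' \/ loopless e'].
Proof.
move=> feas cov [_ [x1 [b1 [x1l b1l xb1]]]] aU al aL cond.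
pose N := [set t | e a t].
have [c' [r' [feas' E]]] := break_tight N feas.
rewrite -/e in E; exists c', r' => e'; rewrite -/e' in E.
have sub s t : e' s t -> e s t by rewrite E => /andP[].
have NM t : t \in N -> exists2 s, e s t & forall u, e s u -> u \in N.
  by rewrite inE => et; exists a => // u eu; rewrite inE.
have [t0 at0] := (cov a aU).1.
(* No looped row is lowered, for a lowered row keeps its loop. Under the first condition the witness
   is x1, tight with every loop; under the second it is a loopless partner of x, which cannot lie in
   [N]. *)
have loopM x : e x x -> [forall u, e x u ==> (u \in N)] = false.
  move=> xx; apply/negbTE/negP=> /forallP xN.
  case: cond => cond.
    case/negP: b1l; apply: (cond x1) => //.
    have xx1 : e x x1 by apply: loops_complete.
    by move: (xN x1); rewrite xx1 inE.
  have [b xb bl] := cond _ xx; case/negP: bl; apply: aL.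
  by move: (xN b); rewrite xb inE.
have loopE x : e x x -> e' x x = (x \notin N) by move=> xx; rewrite E xx loopM.
have out s t : e s t -> t \notin N -> e' s t by move=> st tN; rewrite E st tN orbT.
have nl s : ~~ e s s -> ~~ e' s s by apply: contra; apply: sub.
have bN b : ~~ e b b -> b \notin N by apply: contra; rewrite inE => /aL.
have t0N : t0 \in N by rewrite inE.
split=> //.
- exact: break_covered cov NM E.
- apply: proper_card; apply/properP; split.
    by apply/fintype.subsetP=> x; rewrite !inE; apply: sub.
  by exists t0; rewrite !inE ?(aL _ at0) // loopE ?(aL _ at0) // t0N.
have [x xx'|none] := pickP [pred x | e' x x]; last first.
  by right=> x; have /= -> := none x.
have {}xx' : e' x x := xx'; have xx := sub _ _ xx'.
have xN : x \notin N by rewrite -loopE.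
left; split.
  exists t0, x; split=> //; first by rewrite loopE ?aL ?t0N.
  by apply: out => //; apply: loops_complete => //; apply: aL.
case: cond => cond.
  have x1N : x1 \notin N.
    by rewrite inE; apply: contra b1l => /cond; apply.
  exists x1, b1; split; [by rewrite loopE | exact: nl | exact: out (bN _ b1l)].
have [b xb bl] := cond _ xx; exists x, b; split=> //; first exact: nl.
exact: out (bN _ bl).
Qed.

End Unloop.

Lemma two_way_transpose (S : finType) (e : rel S) :
  two_way e -> two_way (fun x y => e y x).
Proof.
by case=> [[a [x [? ? ?]]] [y [b [? ? ?]]]]; split; [exists b, y | exists x, a].
Qed.

Section UnloopMain.
Variables (R : realType) (S : finType) (m : S -> S -> R).
Hypotheses (m_ge0 : forall s t, 0 <= m s t) (m_diag : forall s, m s s = 0).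

Lemma unloop_step_transpose (U : {set S}) (c r : S -> R) (a : S)
    (e := tight m U c r) :
    feasible m U c r -> covered U e -> two_way e ->
    a \in U -> ~~ e a a -> (forall t, e t a -> e t t) ->
    (forall x b, e x a -> e b x -> e b b) \/
      (forall x, e x x -> exists2 b, e b x & ~~ e b b) ->
  exists c' r' (e' := tight m U c' r'),
    [/\ feasible m U c' r', covered U e', (forall s t, e' s t -> e s t),
        (#|loops e'| < #|loops e|)%N & two_way e' \/ loopless e'].
Proof.
move=> feas cov tw aU al aL cond; pose mT x y := m y x.
have ET c1 r1 : tight mT U r1 c1 = fun x y => tight m U c1 r1 y x.
  by apply/funext=> x; apply/funext=> y; apply: tight_transpose.
have LT c1 r1 : loops (tight mT U r1 c1) = loops (tight m U c1 r1).
  by apply/setP=> x; rewrite !inE ET.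
have [|||||||||r' [c' []]] := @unloop_step R S mT _ _ U r c a.
- by move=> s t; apply: m_ge0.
- by move=> s; apply: m_diag.
- by move=> s t sU tU; rewrite addrC; apply: feas.
- by rewrite ET => s sU; have [] := cov s sU.
- by rewrite ET; apply: two_way_transpose.
- by [].
- by rewrite ET.
- by rewrite ET.
- by rewrite ET.
rewrite !LT ET => feas' cov' sub lt tw'.
exists c', r'; split=> //.
- by move=> s t sU tU; rewrite addrC; apply: feas'.
- by move=> s sU; have [] := cov' s sU.
- by move=> s t st; have := sub t s; rewrite ET; apply.
- by case: tw' => [/two_way_transpose|]; [left | right].
Qed.

(* Call a loopless vertex isolated (predicates A and B) when all its partners on
   one side are loops.  Without isolated vertices the loops can be dropped.
   Otherwise break the loops at an isolated vertex; this keeps [two_way] if its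
   partners have no loopless partner, or if all loops have one.  If neither holds,
   first drop the loops which lack a loopless partner on one of the sides. *)
Lemma unloop (U : {set S}) (c r : S -> R) (e := tight m U c r) :
    feasible m U c r -> covered U e -> two_way e \/ loopless e ->
  exists (U' : {set S}) c' r' (e' := tight m U' c' r'),
    [/\ feasible m U' c' r', covered U' e', loopless e',
        (forall s t, e' s t -> e s t) &
        (forall s, s \in U -> ~~ e s s -> s \in U')].
Proof.
rewrite {}/e; have [n] := ubnP #|loops (tight m U c r)|.
elim: n U c r => // n IHn U c r; set e := tight m U c r; rewrite ltnS => cn feas cov.
case=> [tw|ll]; last by exists U, c, r; split.
have next c' r' (e' := tight m U c' r') :
    [/\ feasible m U c' r', covered U e', (forall s t, e' s t -> e s t),
        (#|loops e'| < #|loops e|)%N & two_way e' \/ loopless e'] ->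
    exists (U' : {set S}) c1 r1 (e1 := tight m U' c1 r1),
    [/\ feasible m U' c1 r1, covered U' e1, loopless e1,
        (forall s t, e1 s t -> e s t) &
        (forall s, s \in U -> ~~ e s s -> s \in U')].
  case=> feas' cov' sub lt tw'.
  have [||||U' [c1 [r1 [f1 cov1 ll1 sub1 U1]]]] := IHn U c' r' => //.
    exact: leq_trans lt cn.
  exists U', c1, r1; split=> // [s t /sub1/sub //|s sU sl]; apply: U1 => //.
  by apply: contra sl; apply: sub.
have restrict (V : {set S}) : V \subset U -> (forall s, s \in U -> ~~ e s s -> s \in V) ->
    (#|loops (tight m V c r)| < #|loops e|)%N ->
    covered V (tight m V c r) -> two_way (tight m V c r) \/ loopless (tight m V c r) ->
    exists (U' : {set S}) c1 r1 (e1 := tight m U' c1 r1),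
    [/\ feasible m U' c1 r1, covered U' e1, loopless e1,
        (forall s t, e1 s t -> e s t) &
        (forall s, s \in U -> ~~ e s s -> s \in U')].
  move=> VU UV lt covV twV; have VU' := fintype.subsetP VU.
  have [||||U' [c1 [r1 [f1 cov1 ll1 sub1 U1]]]] := IHn V c r => //.
  - exact: leq_trans lt cn.
  - by move=> s t /VU' sU /VU' tU; apply: feas.
  exists U', c1, r1; split=> // [s t /sub1|s sU sl].
    by rewrite (tight_restrict m c r s t VU) => /and3P[].
  apply: U1; first exact: UV.
  by rewrite (tight_restrict m c r s s VU) -/e (negbTE sl).
pose A a := [&& a \in U, ~~ e a a & [forall t, e a t ==> e t t]].
pose B a := [&& a \in U, ~~ e a a & [forall t, e t a ==> e t t]].
pose X1 x := e x x && [exists b, e x b && ~~ e b b].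
pose X3 x := e x x && [exists b, e b x && ~~ e b b].
have eU s t : e s t -> (s \in U) && (t \in U) by apply: tight_in.
have [[a0 [xa0 [a0l xa0l ax0]]] [xb0 [b0 [xb0l b0l xb0b]]]] := tw.
have [a Aa|noA] := pickP [pred a | A a && ([forall x, e a x ==> ~~ X1 x] ||
                                          [forall x, e x x ==> X1 x])].
  case/andP: Aa => /and3P [aU al /forallP aL] cond.
  have [||c' [r' H]] := unloop_step m_ge0 m_diag feas cov tw aU al.
  - by move=> t; apply/implyP/aL.
  - case/orP: cond => /forallP cond; [left => x b ax xb | right => x xx].
      apply: contraNT (implyP (cond x) ax) => bl; rewrite /X1 (implyP (aL x) ax).
      by apply/existsP; exists b; rewrite bl andbT.
    by have /andP[_ /existsP[b /andP[]]] := implyP (cond x) xx; exists b.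
  exact: next H.
have [b Bb|noB] := pickP [pred a | B a && ([forall x, e x a ==> ~~ X3 x] ||
                                          [forall x, e x x ==> X3 x])].
  case/andP: Bb => /and3P [bU bl /forallP bL] cond.
  have [||c' [r' H]] := unloop_step_transpose feas cov tw bU bl.
  - by move=> t; apply/implyP/bL.
  - case/orP: cond => /forallP cond; [left => x b' ax xb | right => x xx].
      apply: contraNT (implyP (cond x) ax) => nl; rewrite /X3 (implyP (bL x) ax).
      by apply/existsP; exists b'; rewrite nl andbT.
    by have /andP[_ /existsP[b' /andP[]]] := implyP (cond x) xx; exists b'.
  exact: next H.
(* Both conditions of [unloop_step] fail at [a]; the first failure later saves the partners of [a],
   the second provides a loop to drop. *)
have Aout a : A a -> (exists2 x, e a x & X1 x) /\ (exists2 x, e x x & ~~ X1 x).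
  move=> Aa; have := negbT (noA a); rewrite [X in ~~ X]/= Aa.
  case/norP=> /forallPn[x H1] /forallPn[y H2]; split; [exists x | exists y].
  - by case: (e a x) H1.
  - by case: (X1 x) H1; rewrite ?implybT.
  - by case: (e y y) H2.
  - by case: (X1 y) H2; rewrite ?implybT.
have Bout a : B a -> (exists2 x, e x a & X3 x) /\ (exists2 x, e x x & ~~ X3 x).
  move=> Ba; have := negbT (noB a); rewrite [X in ~~ X]/= Ba.
  case/norP=> /forallPn[x H1] /forallPn[y H2]; split; [exists x | exists y].
  - by case: (e x a) H1.
  - by case: (X3 x) H1; rewrite ?implybT.
  - by case: (e y y) H2.
  - by case: (X3 y) H2; rewrite ?implybT.
have A13 a x : A a -> e a x -> X1 x -> X3 x.
  case/and3P=> _ al _ ax /andP[xx _]; rewrite /X3 xx; apply/existsP; exists a.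
  by rewrite ax al.
have B31 a x : B a -> e x a -> X3 x -> X1 x.
  case/and3P=> _ al _ ax /andP[xx _]; rewrite /X1 xx; apply/existsP; exists a.
  by rewrite ax al.
have outA s : s \in U -> ~~ e s s -> ~~ A s -> exists2 t, e s t & ~~ e t t.
  move=> sU sl; rewrite /A sU sl /= => /forallPn[t].
  by rewrite negb_imply => /andP[? ?]; exists t.
have outB s : s \in U -> ~~ e s s -> ~~ B s -> exists2 t, e t s & ~~ e t t.
  move=> sU sl; rewrite /B sU sl /= => /forallPn[t].
  by rewrite negb_imply => /andP[? ?]; exists t.
(* By [A13] and [B31] an isolated vertex has a partner among the loops kept here, so dropping the
   other loops uncovers nothing. *)
pose V := [set s in U | e s s ==> X1 s && X3 s].
have VU : V \subset U by apply/fintype.subsetP=> s; rewrite inE => /andP[].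
have eV s t : e s t -> s \in V -> t \in V -> tight m V c r s t.
  by move=> st sV tV; rewrite (tight_restrict _ _ _ _ _ VU) -/e st sV tV.
have nlV s : s \in U -> ~~ e s s -> s \in V.
  by move=> sU sl; rewrite inE sU (negbTE sl).
have X13V x : X1 x -> X3 x -> x \in V.
  by move=> x1 x3; rewrite inE x1 x3 implybT andbT; case/andP: x1 => /eU/andP[].
have V_e s t : tight m V c r s t -> e s t.
  by rewrite (tight_restrict _ _ _ _ _ VU) => /and3P[].
have [x xA|A0] := pickP [pred a | A a || B a]; last first.
  pose W := [set s in U | ~~ e s s].
  have WU : W \subset U by apply/fintype.subsetP=> s; rewrite inE => /andP[].
  have eW s t : e s t -> ~~ e s s -> ~~ e t t -> tight m W c r s t.
    move=> st sl tl; rewrite (tight_restrict _ _ _ _ _ WU) -/e st !inE sl tl.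
    by case/andP: (eU _ _ st) => -> ->.
  have llW : loopless (tight m W c r).
    move=> s; rewrite (tight_restrict _ _ _ _ _ WU) -/e; apply/negP => /and3P[ss].
    by rewrite inE ss andbF.
  apply: (restrict W) => //; last by right.
  - by move=> s sU sl; rewrite inE sU.
  - apply: proper_card; apply/properP; split; last by exists xa0; rewrite !inE ?xa0l.
    by apply/fintype.subsetP=> s; rewrite !inE (negbTE (llW s)).
  - move=> s; rewrite inE => /andP[sU sl].
    have /norP[nA nB] : ~~ (A s || B s) by have /= -> := A0 s.
    have [t st tl] := outA s sU sl nA; have [u us ul] := outB s sU sl nB.
    by split; [exists t | exists u]; apply: eW.
apply: (restrict V) => //.
- apply: proper_card; apply/properP; split.
    by apply/fintype.subsetP=> s; rewrite !inE; apply: V_e.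
  have [y yy ny] : exists2 y, e y y & ~~ (X1 y && X3 y).
    case/orP: xA => [/Aout[_ [y yy ny]]|/Bout[_ [y yy ny]]]; exists y => //;
      by rewrite negb_and ny ?orbT.
  exists y; rewrite ?inE //; apply/negP => /tight_in /andP[+ _].
  by rewrite inE yy (negbTE ny) andbF.
- move=> s sV; have sU := fintype.subsetP VU _ sV.
  have [ss|sl] := boolP (e s s); first by split; exists s; apply: eV.
  split.
    have [As|nA] := boolP (A s).
      have [[y sy y1] _] := Aout s As; exists y; apply: eV => //.
      exact: X13V (A13 _ _ As sy y1).
    have [t st tl] := outA s sU sl nA; exists t; apply: eV => //; apply: nlV => //.
    by case/andP: (eU _ _ st).
  have [Bs|nB] := boolP (B s).
    have [[y sy y1] _] := Bout s Bs; exists y; apply: eV => //.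
    exact: X13V (B31 _ _ Bs sy y1) y1.
  have [t st tl] := outB s sU sl nB; exists t; apply: eV => //; apply: nlV => //.
  by case/andP: (eU _ _ st).
left; have [y y1 y3] : exists2 y, X1 y & X3 y.
  case/orP: xA => [Ax|Bx].
    by have [[y xy y1] _] := Aout x Ax; exists y => //; apply: A13 xy y1.
  by have [[y xy y1] _] := Bout x Bx; exists y => //; apply: B31 xy y1.
have yV := X13V y y1 y3.
case/andP: (y1) => yy /existsP[b /andP[yb bl]].
case/andP: (y3) => _ /existsP[a /andP[ay al]].
have bV : b \in V by apply: nlV => //; case/andP: (eU _ _ yb).
have aV : a \in V by apply: nlV => //; case/andP: (eU _ _ ay).
split; [exists a, y | exists y, b].
  by split; [apply: contra al; apply: V_e | apply: eV | apply: eV].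
by split; [apply: eV | apply: contra bl; apply: V_e | apply: eV].
Qed.

End UnloopMain.

(** * From a tight graph to potentials with a circulation *)

Section Certificate.
Variables (R : realType) (S : finType) (m : S -> S -> R).
Hypotheses (m_ge0 : forall s t, 0 <= m s t) (m_diag : forall s, m s s = 0).

(** All of S are terminals, also the vertices dropped from [U]. They receive a potential [C] large
    enough for feasibility with everything else. Inside [U] positivity is looplessness, because the
    diagonal of [m] is zero. *)
Lemma feasible_extend (U : {set S}) (c r : S -> R) :
    feasible m U c r -> loopless (tight m U c r) ->
  exists c' r' : S -> R, [/\ forall s t, m s t <= c' s + r' t,
    forall s, 0 < c' s + r' s &
    forall s t, s \in U -> t \in U -> (c' s + r' t == m s t) = tight m U c r s t].
Proof.
move=> feas ll; pose C := 1 + \sum_s (`|c s| + `|r s|) + \sum_s \sum_t m s t.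
have sum0 : 0 <= \sum_s (`|c s| + `|r s|) by apply: sumr_ge0 => s _; apply: addr_ge0.
have summ : 0 <= \sum_s \sum_t m s t by apply: sumr_ge0 => s _; apply: sumr_ge0.
have cr_le s : `|c s| + `|r s| <= \sum_s (`|c s| + `|r s|).
  by rewrite (bigD1 s) //= lerDl; apply: sumr_ge0 => t _; apply: addr_ge0.
have m_le s t : m s t <= \sum_s \sum_t m s t.
  rewrite (bigD1 s) //= (bigD1 t) //= -addrA lerDl.
  by apply: addr_ge0; apply: sumr_ge0 => // u _; apply: sumr_ge0.
have bound s t : `|c s| + m t s <= C /\ `|r s| + m s t <= C.
  have := cr_le s; have := m_le s t; have := m_le t s.
  by rewrite /C; have := normr_ge0 (c s); have := normr_ge0 (r s); split; lra.
have abs s : - `|c s| <= c s /\ - `|r s| <= r s.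
  by split; rewrite lerNl ler_normr lexx orbT.
exists (fun s => if s \in U then c s else C), (fun s => if s \in U then r s else C).
split=> [s t|s|s t sU tU]; last by rewrite sU tU /tight sU tU.
- case sU: (s \in U); case tU: (t \in U); first exact: feas.
  + by have [] := bound s t; have [] := abs s; have [] := bound t s;
      have := m_ge0 t s; have := normr_ge0 (r s); rewrite /C; have := cr_le s; have := m_le s t; lra.
  + by have := cr_le t; have [] := abs t; have := normr_ge0 (c t); rewrite /C; have := m_le s t; lra.
  + by rewrite /C; have := m_le s t; lra.
- case sU: (s \in U); last by rewrite /C; lra.
  rewrite lt_neqAle -{2}(m_diag s) feas // andbT eq_sym.
  by have := ll s; rewrite /tight sU /= m_diag.
Qed.

Lemma circulation_certificate (U : {set S}) (c r : S -> R) (e := tight m U c r)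
    (s : 'I_3 -> S) :
    feasible m U c r -> covered U e -> two_way e \/ loopless e ->
    (forall i, s i \in U) -> (forall i, ~~ e (s i) (s i)) ->
    (forall i j, i != j -> apart e (s i) (s j)) ->
  exists (c' r' : S -> R) (x y : 'I_3 -> S) (w : S -> S -> nat),
    [/\ [/\ forall s t, m s t <= c' s + r' t, forall s, 0 <= c' s,
            forall s, 0 <= r' s & forall s, 0 < c' s + r' s],
        forall i j, (c' (x i) + r' (y j) == m (x i) (y j)) = (i == j),
        forall s t, (0 < w s t)%N -> c' s + r' t = m s t,
        balanced w & forall i, (0 < w (x i) (y i))%N].
Proof.
move=> feas cov tw sU sl sA.
have [U1 [c1 [r1 [feas1 cov1 ll1 sub1 sU1]]]] := unloop m_ge0 m_diag feas cov tw.
have [c2 [r2 [feas2 cov2 sub2 rect2]]] := rectangular_potential feas1 cov1.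
have ll2 : loopless (tight m U1 c2 r2) by move=> t; apply: contra (ll1 t) => /sub2.
have [x [y [w [exy we wb wp]]]] : exists (x y : 'I_3 -> S) (w : S -> S -> nat),
    [/\ forall i j, tight m U1 c2 r2 (x i) (y j) = (i == j),
        forall s t, (0 < w s t)%N -> tight m U1 c2 r2 s t, balanced w
      & forall i, (0 < w (x i) (y i))%N].
  apply: (@three_class_circulation _ _ U1 _ _ _ ll2 rect2 s).
  - by move=> ? ?; apply: tight_in.
  - by move=> t /cov2[].
  - by move=> t /cov2[].
  - by move=> i; apply: sU1.
  - by move=> i j /sA ij u /sub2/sub1/ij; apply: contra => /sub2/sub1.
have [c3 [r3 [f3 pos3 E3]]] := feasible_extend feas2 ll2.
have inU a b : tight m U1 c2 r2 a b -> a \in U1 /\ b \in U1 by case/tight_in/andP.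
have xU i : x i \in U1 by have [] := inU _ _ (we _ _ (wp i)).
have yU i : y i \in U1 by have [] := inU _ _ (we _ _ (wp i)).
(* Moving along (1, -1) changes no sum. Once the least value of [c3] is zero, feasibility at s0
   makes the other potential nonnegative. *)
have [s0 _ cmin] := @arg_minP _ _ _ (x ord0) xpredT c3 isT.
exists (fun s => c3 s - c3 s0), (fun s => r3 s + c3 s0), x, y, w.
have cE a b : c3 a - c3 s0 + (r3 b + c3 s0) = c3 a + r3 b by ring.
split=> //; last 2 first.
- by move=> i j; rewrite cE E3.
- by move=> a b wab; rewrite cE; apply/eqP; have /[dup] := we _ _ wab;
    move=> /inU[aU bU]; rewrite E3.
split=> [a b|a|a|a]; rewrite ?cE //.
- by rewrite subr_ge0 cmin.
- by rewrite addrC; apply: le_trans (f3 s0 a).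
Qed.

End Certificate.

(** * Faces of the polyhedra *)

Lemma bigmax_ord_witness (N n : nat) (P : 'I_N -> Prop) :
  (0 < n)%N -> (n <= \max_(d < N | `[< P d >]) d)%N -> exists2 d : 'I_N, (n <= d)%N & P d.
Proof.
move=> n0; apply: contraPP => nP; apply/negP; rewrite -ltnNge -(prednK n0) ltnS.
apply/bigmax_leqP=> d /asboolP Pd; rewrite -ltnS prednK // ltnNge.
by apply/negP=> nd; apply: nP; exists d.
Qed.

Section Directions.
Variables (R : realType) (I : finType).
Local Notation point := {ffun I -> R^o}.

Lemma affdim_witness (A : set point) n : (0 < n)%N -> (n <= affdim A)%N ->
  exists2 d, (n <= d)%N & has_affine_free A d.
Proof. by move=> n0 /(bigmax_ord_witness n0)[d nd fd]; exists (nat_of_ord d). Qed.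

Lemma leq_affdim (A : set point) d : (d <= #|I|)%N -> has_affine_free A d ->
  (d <= affdim A)%N.
Proof.
rewrite -ltnS => dI fd.
by apply: (@leq_bigmax_cond _ _ (fun d => nat_of_ord d) (Ordinal dI)); apply/asboolP.
Qed.

Definition coordinate (i : I) (v : point) : R^o := v i.

Lemma coordinate_linear i : linear (coordinate i).
Proof. by move=> a u v; rewrite /coordinate !ffunE. Qed.

HB.instance Definition _ i :=
  GRing.isLinear.Build R point R^o _ (coordinate i) (coordinate_linear i).

Lemma dim_vanishing (V : {vspace point}) (i : I) n : (n < \dim V)%N ->
  exists W : {vspace point}, [/\ (n <= \dim W)%N, (W <= V)%VS &
    forall v, v \in W -> v i = 0].
Proof.
move=> nV; pose f := linfun (coordinate i).
exists (V :&: lker f)%VS; split; last 1 first.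
- by move=> v; rewrite memv_cap memv_ker => /andP[_]; rewrite lfunE => /eqP.
- have : (\dim (f @: V) <= 1)%N by rewrite (leq_trans (dimvS (subvf _))) ?dimvf.
  move=> d1; rewrite -ltnS; apply: leq_trans nV _.
  by rewrite -(limg_ker_dim f V) -[X in (_ <= X)%N]addn1 leq_add2l.
- exact: capvSl.
Qed.

Lemma dim_nonzero (V : {vspace point}) : (0 < \dim V)%N ->
  exists2 v, v \in V & exists i, v i != 0.
Proof.
rewrite lt0n dimv_eq0 -vpick0 => v0; exists (vpick V); first exact: memv_pick.
apply: contrapT => H; case/negP: v0; apply/eqP/ffunP=> i; rewrite ffunE.
by apply/eqP/negPn/negP=> vi; apply: H; exists i.
Qed.

(** The case i = j is meant too: it expresses the vanishing of a single coordinate, and is used for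
    the zero coordinates of points of [Tmu]. *)
Lemma span_coordinate0 (X : seq point) (v : point) i j :
  (forall x, x \in X -> x i + x j = 0) -> v \in <<X>>%VS -> v i + v j = 0.
Proof.
move=> X0 vX; pose f := linfun (coordinate i) + linfun (coordinate j).
have : (<<X>> <= lker f)%VS.
  apply/span_subvP => x /X0 xij; rewrite memv_ker add_lfunE !lfunE /=.
  by rewrite /coordinate xij.
by move/subvP/(_ v vX); rewrite memv_ker add_lfunE !lfunE /= => /eqP.
Qed.

End Directions.

Section Faces.
Variables (R : realType) (S : finType) (mu : S -> S -> R).
Local Notation point := {ffun S + S -> R^o}.
Local Notation col p := (fun s : S => (p : point) (inl s) : R).
Local Notation row p := (fun s : S => (p : point) (inr s) : R).

Definition tight_at (p : point) (s t : S) : bool := p (inl s) + p (inr t) == mu s t.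

(** For [p] in [Pmu] these are the directions of the smallest face containing [p]. *)
Definition preserves_tight (p : point) (u : point) : Prop :=
  forall s t, tight_at p s t -> u (inl s) + u (inr t) = 0.

Lemma tight_atE p s t : tight_at p s t = tight mu [set: S] (col p) (row p) s t.
Proof. by rewrite /tight !inE. Qed.

Lemma Kadj_eq (p q : point) : tight_at p =2 tight_at q -> Kadj mu p =2 Kadj mu q.
Proof. by move=> pq [s|s] [t|t] //=; apply: pq. Qed.

Lemma lower_coordinate (p : point) (v : S + S) : Pmu mu p ->
    (forall z, ~~ Kadj mu p v z) ->
  exists2 e : R, 0 < e & forall d, 0 <= d <= e ->
    Pmu mu ([ffun z => p z - d *+ (z == v)] : point).
Proof.
move=> Pp vK; pose slack (st : S * S) := p (inl st.1) + p (inr st.2) - mu st.1 st.2.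
have [|e e0 eP] := @positive_lower_bound R _
    [pred st : S * S | (inl st.1 == v) || (inr st.2 == v)] slack.
  case=> s t /= stv; rewrite lt_neqAle subr_ge0 Pp andbT eq_sym subr_eq0.
  by case/orP: stv => /eqP E; [have := vK (inr t) | have := vK (inl s)]; rewrite -E.
exists e => // d /andP[d0 de] s t; rewrite !ffunE /=.
have := eP (s, t); rewrite /slack /=; have := Pp s t.
have : ~~ ((inl s == v) && (inr t == v)).
  by apply/negP=> /andP[/eqP <- /eqP].
case: (inl s == v); case: (inr t == v) => //= _ h1 h2;
  rewrite ?mulr1n ?mulr0n; move: h1; try (move: (h2 isT)); lra.
Qed.

Lemma lowered_neq (p : point) v (d : R) : 0 < d ->
  ([ffun z => p z - d *+ (z == v)] : point) <> p.
Proof.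
by move=> d0 /ffunP/(_ v); rewrite ffunE eqxx mulr1n; move: d0; lra.
Qed.

Lemma Qmu_partner (p : point) v : Qmu mu p -> exists z, Kadj mu p v z.
Proof.
case=> Pp pmin; apply: contrapT => nK.
have [|e e0 eP] := @lower_coordinate p v Pp.
  by move=> z; apply/negP=> K; apply: nK; exists z.
apply: (@lowered_neq p v e e0); apply: pmin.
  by apply: eP; rewrite lexx ltW.
by move=> i; rewrite ffunE; case: (i == v); rewrite ?mulr1n ?mulr0n; move: e0; lra.
Qed.

Lemma Tmu_partner (p : point) v : Tmu mu p -> 0 < p v -> exists z, Kadj mu p v z.
Proof.
case=> [[Pp p0] pmin] pv; apply: contrapT => nK.
have [|e e0 eP] := @lower_coordinate p v Pp.
  by move=> z; apply/negP=> K; apply: nK; exists z.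
pose d := Num.min e (p v).
have d0 : 0 < d by rewrite lt_min e0.
apply: (@lowered_neq p v d d0); apply: pmin.
  split; first by apply: eP; rewrite ltW //= ge_min lexx.
  move=> i; rewrite ffunE; case: eqP => [->|_]; last by rewrite mulr0n subr0.
  by rewrite mulr1n subr_ge0 ge_min lexx orbT.
by move=> i; rewrite ffunE; case: (i == v); rewrite ?mulr1n ?mulr0n; move: d0; lra.
Qed.

Lemma preserves_partner (p u : point) v z : preserves_tight p u -> Kadj mu p v z -> u v + u z = 0.
Proof.
case: v z => [s|s] [t|t] //= ou K; first exact: ou.
by rewrite addrC; apply: ou.
Qed.

(** Minimality gives each positive coordinate of p a tight partner, so every nonzero direction is
    visible on a tight pair with positive potentials. A second direction, zero on the first pair and
    nonzero on another, shows that the cross pairs are slack. *)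
Lemma Tmu_certificate : (2 <= dim_Tmu mu)%N ->
  exists (c r : S -> R) (x y : bool -> S),
    [/\ forall s t, mu s t <= c s + r t, forall s, 0 <= c s /\ 0 <= r s,
        forall s, 0 < c s + r s, forall i, 0 < mu (x i) (y i) &
        forall i j, (c (x i) + r (y j) == mu (x i) (y j)) = (i == j)].
Proof.
rewrite /dim_Tmu => dT.
have [d d2 [F [[_ [f [b [_ FE]]]] FT Fd]]] := bigmax_ord_witness (ltn0Sn 1) dT.
have [||d' d'2 [p0 [us [Fp0 Fu uf]]]] := @affdim_witness R _ F 2; rewrite ?Fd //.
have [u1 [u2 [l uE]]] : exists u1 u2 l, tval us = u1 :: u2 :: l.
  case: us d'2 {Fu uf} => [[|u1 [|u2 l]] /= /eqP <-] // _; by exists u1, u2, l.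
have Fmem u : u \in tval us -> F (p0 + u).
  by case/tnthP=> i ->.
have {uf} uf : free [:: u1; u2].
  by move: uf; rewrite uE -[_ :: _]/([:: u1; u2] ++ l); apply: catl_free.
have F1 : F (p0 + u1) by apply: Fmem; rewrite uE !inE eqxx.
have F2 : F (p0 + u2) by apply: Fmem; rewrite uE !inE eqxx orbT.
(* The centroid of three affinely independent points of F: a constraint tight at p is tight at all
   three, so both directions preserve it. *)
pose p : point := p0 + 3^-1 *: (u1 + u2).
have pE z : p z = (p0 z + (p0 z + u1 z) + (p0 z + u2 z)) / 3.
  by rewrite /p !ffunE /GRing.scale /=; field.
have cE : \sum_i f i * p i =
    (\sum_i f i * p0 i + \sum_i f i * (p0 + u1) i + \sum_i f i * (p0 + u2) i) / 3.
  rewrite -!big_split /= mulr_suml; apply: eq_bigr => i _.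
  by rewrite pE !ffunE; field.
move: Fp0 F1 F2; rewrite FE => -[[P0 N0] c0] [[P1 N1] c1] [[P2 N2] c2].
have Fp : F p.
  rewrite FE; split; last by rewrite cE c0 c1 c2; field.
  split=> [s t|z]; rewrite !pE.
    by have := P0 s t; have := P1 s t; have := P2 s t; rewrite !ffunE; lra.
  by have := N0 z; have := N1 z; have := N2 z; rewrite !ffunE; lra.
have [[Pp Np] _] := FT _ Fp.
have ou u : u \in [:: u1; u2] -> preserves_tight p u.
  move=> uu s t /eqP; rewrite !pE => pst.
  have := P0 s t; have := P1 s t; have := P2 s t; rewrite !ffunE.
  by move: uu; rewrite !inE => /orP[] /eqP -> {u}; lra.
have zu u z : u \in [:: u1; u2] -> p z = 0 -> u z + u z = 0.
  move=> uu; rewrite pE => pz.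
  have := N0 z; have := N1 z; have := N2 z; rewrite !ffunE.
  by move: uu; rewrite !inE => /orP[] /eqP -> {u}; lra.
pose V := <<[:: u1; u2]>>%VS.
have dimV : \dim V = 2 by move: uf => /eqP.
have oV v : v \in V -> preserves_tight p v.
  by move=> vV s t pst; apply: span_coordinate0 vV => u uu; apply: ou.
have live v z : v \in V -> v z != 0 -> p z != 0.
  move=> vV; apply: contraNN => /eqP pz; have : v z + v z = 0.
    by apply: span_coordinate0 vV => u uu; apply: zu.
  by move=> vz; apply/eqP; lra.
have liveE v : v \in V -> (exists z, v z != 0) ->
    exists s t, [/\ tight_at p s t, 0 < p (inl s), 0 < p (inr t) & v (inl s) != 0].
  move=> vV [z vz]; have pz : 0 < p z by rewrite lt_neqAle eq_sym (live v) //=.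
  have [z' K] := Tmu_partner (FT _ Fp) pz.
  have vz' : v z' != 0.
    apply: contraNN vz => /eqP vz'; have := preserves_partner (oV v vV) K.
    by rewrite vz' addr0 => ->.
  have pz' : 0 < p z' by rewrite lt_neqAle eq_sym (live v) //=.
  by case: z z' K vz vz' pz pz' => [s|t] [t'|s'] //= K *; [exists s, s' | exists t', t].
have [v1 v1V /(liveE _ v1V) [s1 [t1 [T1 ps1 pt1 v1s]]]] : exists2 v, v \in V & exists z, v z != 0.
  by apply: dim_nonzero; rewrite dimV.
have [|W [dW WV W0]] := @dim_vanishing R _ V (inl s1) 1; first by rewrite dimV.
have [v2 v2W v2nz] := dim_nonzero dW; have v2V := subvP WV _ v2W.
have [s2 [t2 [T2 ps2 pt2 v2s]]] := liveE _ v2V v2nz.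
have o2 := oV _ v2V; have v20 := W0 _ v2W.
have n12 : ~~ tight_at p s1 t2.
  apply: contraNN v2s => /o2; rewrite v20 add0r => v2t.
  by have := o2 _ _ T2; rewrite v2t addr0 => ->.
have n21 : ~~ tight_at p s2 t1.
  apply: contraNN v2s => /o2; have := o2 _ _ T1; rewrite v20 add0r => ->.
  by rewrite addr0 => ->.
pose x (i : bool) := if i then s1 else s2; pose y (i : bool) := if i then t1 else t2.
have px i : 0 < p (inl (x i)) by case: i.
have py i : 0 < p (inr (y i)) by case: i.
(* Raising all other rows and columns by one makes every [c s + r s] positive and leaves the four
   sums of the two pairs unchanged. *)
pose Cx s := (s == s1) || (s == s2); pose Cy s := (s == t1) || (s == t2).
have Cxx i : Cx (x i) by rewrite /Cx; case: i; rewrite eqxx ?orbT.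
have Cyy i : Cy (y i) by rewrite /Cy; case: i; rewrite eqxx ?orbT.
exists (fun s => p (inl s) + (~~ Cx s)%:R), (fun s => p (inr s) + (~~ Cy s)%:R), x, y.
have tE i j : (p (inl (x i)) + p (inr (y j)) == mu (x i) (y j)) = (i == j).
  by case: i j => [] []; rewrite ?[LHS]T1 ?[LHS]T2 ?[LHS](negbTE n12) ?[LHS](negbTE n21).
have b0 (b1 : bool) : 0 <= b1%:R :> R by rewrite ler0n.
split=> [s t|s|s|i|i j].
- by have := Pp s t; have := b0 (~~ Cx s); have := b0 (~~ Cy t); lra.
- by have := Np (inl s); have := Np (inr s); have := b0 (~~ Cx s); have := b0 (~~ Cy s); split; lra.
- have h1 := Np (inl s); have h2 := Np (inr s).
  have [Cs|_] := boolP (Cx s); last by rewrite /=; have := b0 (~~ Cy s); lra.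
  have : 0 < p (inl s) by case/orP: Cs => /eqP ->.
  by rewrite /=; have := b0 (~~ Cy s); lra.
- by have := tE i i; rewrite eqxx => /eqP <-; apply: addr_gt0.
- by rewrite Cxx Cyy !addr0 tE.
Qed.

End Faces.

(** * Faces of slim points *)

Section Slim.
Variables (R : realType) (S : finType) (mu : S -> S -> R).
Hypothesis hmu : directed_distance mu.
Local Notation point := {ffun S + S -> R^o}.
Local Notation col p := (fun s : S => (p : point) (inl s) : R).
Local Notation row p := (fun s : S => (p : point) (inr s) : R).
Local Notation tightp := (tight_at mu).
Local Notation pres := (preserves_tight mu).

(** The segment from q to p can be prolonged inside F; a positive slack at q would turn negative
    beyond p. *)
Lemma relint_tight (F : set point) (p q : point) s t :
  (F `<=` Pmu mu)%classic -> relint F p -> F q -> tightp p s t -> tightp q s t.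
Proof.
move=> FP [Fp rp] Fq /eqP pst; have [e e0 /FP/(_ s t)] := rp _ Fq.
have /(_ s t) := FP _ Fq; rewrite !ffunE /GRing.scale /= => h1 h2.
apply/eqP/le_anti; rewrite h1 andbT -subr_le0 -(pmulr_rle0 _ e0).
have -> : e * (q (inl s) + q (inr t) - mu s t) = mu s t -
    (p (inl s) + e * (p (inl s) - q (inl s)) + (p (inr t) + e * (p (inr t) - q (inr t)))).
  by rewrite -pst; ring.
by rewrite subr_le0.
Qed.

Lemma move_preserving (p u : point) : Pmu mu p -> pres p u ->
  exists2 e : R, 0 < e & forall d, `|d| <= e ->
    Pmu mu (p + d *: u) /\ tightp (p + d *: u) =2 tightp p.
Proof.
move=> Pp ou; pose slack (st : S * S) := p (inl st.1) + p (inr st.2) - mu st.1 st.2.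
have [|e e0 eP] := @positive_lower_bound R _ [pred st | slack st != 0] slack.
  by case=> s t /=; rewrite lt_neqAle subr_ge0 Pp eq_sym => ->.
pose M := 1 + \sum_z `|u z|.
have M0 : 0 < M.
  have : 0 <= \sum_z `|u z| by apply: sumr_ge0.
  by rewrite /M; lra.
have uM s t : `|u (inl s) + u (inr t)| < M.
  apply: le_lt_trans (ler_normD _ _) _.
  rewrite /M (bigD1 (inl s)) //= (bigD1 (inr t)) //=.
  set T := \sum_(_ | _) _; have T0 : 0 <= T by apply: sumr_ge0.
  by lra.
exists (e / M) => [|d dM]; first by rewrite divr_gt0.
have slE s t : (p + d *: u) (inl s) + (p + d *: u) (inr t) - mu s t =
    slack (s, t) + d * (u (inl s) + u (inr t)).
  by rewrite !ffunE /slack /GRing.scale /=; ring.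
have key s t : 0 <= slack (s, t) + d * (u (inl s) + u (inr t)) /\
    (slack (s, t) + d * (u (inl s) + u (inr t)) == 0) = (slack (s, t) == 0).
  have [s0|sn] := eqVneq (slack (s, t)) 0.
    have pst : tightp p s t by rewrite /tight_at -subr_eq0; apply/eqP.
    by rewrite s0 ou // mulr0 addr0 eqxx.
  have se : e <= slack (s, t) by apply: eP.
  have : `|d * (u (inl s) + u (inr t))| < e.
    rewrite normrM; apply: le_lt_trans (_ : e / M * `|u (inl s) + u (inr t)| < _).
      exact: ler_wpM2r.
    by rewrite mulrAC ltr_pdivrMr // ltr_pM2l.
  rewrite ltr_norml => /andP[h _].
  have lt0 : 0 < slack (s, t) + d * (u (inl s) + u (inr t)) by lra.
  by split; [apply: ltW | rewrite gt_eqF].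
split=> [s t|s t].
  by rewrite -subr_ge0 slE; have [] := key s t.
by rewrite /tight_at -subr_eq0 slE (key s t).2 subr_eq0.
Qed.

(** Small moves along [u] and against it both stay in [Pmu], so the functional supporting F is
    constant along [u]. *)
Lemma face_move (F : set point) (p u : point) : is_face (Pmu mu) F -> F p -> pres p u ->
  exists e : R, [/\ 0 < e, F (p + e *: u) & tightp (p + e *: u) =2 tightp p].
Proof.
move=> [_ [c [b [cb FE]]]] Fp ou; have [Pp cp] : Pmu mu p /\ \sum_i c i * p i = b.
  by move: Fp; rewrite FE.
have [e e0 eP] := move_preserving Pp ou; exists e.
have [|Pe te] := eP e; first by rewrite gtr0_norm.
have [|Pn _] := eP (- e); first by rewrite normrN gtr0_norm.
have cE d : \sum_i c i * (p + d *: u) i = b + d * \sum_i c i * u i.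
  rewrite -cp mulr_sumr -big_split /=; apply: eq_bigr => i _.
  by rewrite !ffunE /GRing.scale /=; ring.
split=> //; rewrite FE; split=> //.
by have := cb _ Pe; have := cb _ Pn; rewrite !cE; lra.
Qed.

Lemma shiftE (X : {set S}) s :
  (shift R X (inl s) = (s \in X)%:R) * (shift R X (inr s) = - (s \in X)%:R).
Proof. by rewrite !ffunE. Qed.

(** Rows are chosen one after another, each with a direction that vanishes at the earlier ones. A
    column tight with two rows forces a direction to take the same value on both, so these rows are
    apart. *)
Lemma separated_triple (V : {vspace point}) (Y : {set S}) (e : rel S) :
    (3 <= \dim V)%N ->
    (forall v s t, v \in V -> e s t -> v (inl s) + v (inr t) = 0) ->
    (forall v, v \in V -> (exists z, v z != 0) -> exists2 s, s \in Y & v (inl s) != 0) ->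
  exists s : 'I_3 -> S, (forall i, s i \in Y) /\
    forall i j, i != j -> apart e (s i) (s j).
Proof.
move=> V3 Ve VY.
have [v1 v1V /(VY _ v1V) [s1 s1Y v1s]] := dim_nonzero (ltnW (ltnW V3)).
have [W [W2 WV W0]] := @dim_vanishing R _ V (inl s1) 2 V3.
have [v2 v2W v2n] := dim_nonzero (ltnW W2); have v2V := subvP WV _ v2W.
have [s2 s2Y v2s] := VY _ v2V v2n.
have [W' [W'1 W'W W'0]] := @dim_vanishing R _ W (inl s2) 1 W2.
have [v3 v3W' v3n] := dim_nonzero W'1; have v3W := subvP W'W _ v3W'.
have v3V := subvP WV _ v3W; have [s3 s3Y v3s] := VY _ v3V v3n.
have sep v s t : v \in V -> v (inl s) = 0 -> v (inl t) != 0 -> apart e s t.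
  move=> vV vs vt u su; apply: contraNN vt => tu.
  have := Ve _ _ _ vV su; rewrite vs add0r => vu.
  by have := Ve _ _ _ vV tu; rewrite vu addr0 => ->.
have a12 := sep _ _ _ v2V (W0 _ v2W) v2s.
have a13 := sep _ _ _ v3V (W0 _ v3W) v3s.
have a23 := sep _ _ _ v3V (W'0 _ v3W') v3s.
exists (tnth [tuple s1; s2; s3]); split.
  by move=> i; rewrite (tnth_nth s1); case: i => [[|[|[|]]]].
move=> i j; rewrite !(tnth_nth s1).
by case: i => [[|[|[|]]]] // ?; case: j => [[|[|[|]]]] // ? //= _; apply: apart_sym.
Qed.

Section Face.
Variables (F : set point) (p : point).
Hypotheses (face : is_face (Pmu mu) F) (slim : (F `<=` Qslim mu)%classic)
  (rp : relint F p).
Let X := [set s | tightp p s s].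

Lemma face_Qmu q : F q -> Qmu mu q. Proof. by move/slim => []. Qed.

Lemma face_directions n : (0 < n)%N -> (n <= affdim F)%N ->
  exists V : {vspace point}, (n <= \dim V)%N /\ forall v, v \in V -> pres p v.
Proof.
move=> n0 /(affdim_witness n0) [d nd [p0 [us [Fp0 Fu /eqP fu]]]].
exists <<us>>%VS; split=> [|v vV s t pst]; first by rewrite fu size_tuple.
have FP : (F `<=` Pmu mu)%classic by move=> q /face_Qmu[].
apply: span_coordinate0 vV => u /tnthP [i ->].
have /eqP := relint_tight FP rp Fp0 pst.
have /eqP := relint_tight FP rp (Fu i) pst.
by rewrite !ffunE; move=> h1 h2; lra.
Qed.

Lemma loops_tight x y : x \in X -> y \in X -> tightp p x y.
Proof.
rewrite !inE !tight_atE; case: hmu => mu0 mud.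
apply: loops_complete => // s t _ _; have [Fp _] := rp.
exact: (face_Qmu Fp).1.
Qed.

Lemma loops_zero_family : zero_family mu X.
Proof.
move=> x y xX yX; case: hmu => mu0 mud; have := mu0 x y; have := mu0 y x.
have /eqP := loops_tight xX yX; have /eqP := loops_tight yX xX.
by have /eqP := loops_tight xX xX; have /eqP := loops_tight yX yX; rewrite !mud; lra.
Qed.

Lemma QmuX_loops q : F q -> tightp q =2 tightp p -> QmuX mu X q.
Proof.
by move=> Fq qp; split; [exact: face_Qmu | move=> s; rewrite inE -qp].
Qed.

Lemma Qdeg_eq q Z : F q -> tightp q =2 tightp p -> Qdeg mu Z p -> Qdeg mu Z q.
Proof.
move=> Fq qp [[_ Zp] deg]; split.
  by split; [exact: face_Qmu | move=> s; rewrite -Zp; apply: qp].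
have nE U : nbhd mu q U = nbhd mu p U.
  apply/setP=> v; rewrite !inE; congr andb; apply: eq_existsb => u.
  by rewrite (Kadj_eq qp).
by rewrite !nE.
Qed.

Definition slim_class : set point := [set q | F q /\ slim_equiv mu q p].

Lemma slim_class_base : slim_class p.
Proof.
by split; [case: rp | left; exists 0; rewrite subrr scale0r].
Qed.

Lemma slim_class_shift : exists2 e : R, 0 < e & slim_class (p + e *: shift R [set: S]).
Proof.
have [Fp _] := rp.
have [|e [e0 Fe _]] := @face_move F p (shift R [set: S]) face Fp.
  by move=> s t _; rewrite !shiftE !inE subrr.
by exists e => //; split=> //; left; exists e; rewrite addrC addKr.
Qed.

Lemma slim_class_dim1 (s : S) : (1 <= affdim slim_class)%N.
Proof.
have [e e0 Ee] := slim_class_shift.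
apply: leq_affdim; first by apply/card_gt0P; exists (inl s).
exists p, [tuple e *: shift R [set: S]]; split; first exact: slim_class_base.
  by move=> i; rewrite (tnth_nth 0); case: i => [[|]].
rewrite seq1_free; apply/eqP => /ffunP/(_ (inl s)).
by rewrite !ffunE /GRing.scale /= inE mulr1; move: e0; lra.
Qed.

Lemma slim_class_dim2 x y : x \in X -> y \notin X -> Qdeg mu X p -> pres p (shift R X) ->
  (2 <= affdim slim_class)%N.
Proof.
move=> xX yX deg pX; have [e e0 Ee] := slim_class_shift.
have [Fp _] := rp; have [f [f0 Ff tf]] := face_move face Fp pX.
have Ef : slim_class (p + f *: shift R X).
  split=> //; right; exists X; split=> //; first exact: loops_zero_family.
    exact: Qdeg_eq tf deg.
  by exists 0, f; rewrite addrC addKr scale0r add0r.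
apply: leq_affdim.
  have : [set inl x; inl y : S + S]%SET \subset predT by apply/fintype.subsetP.
  by move/subset_leq_card; rewrite cards2; case: eqP => // -[xy]; rewrite -xy xX in yX.
exists p, [tuple e *: shift R [set: S]; f *: shift R X]; split.
- exact: slim_class_base.
- by move=> i; rewrite (tnth_nth 0); case: i => [[|[|]]].
rewrite free_cons span_seq1 seq1_free; apply/andP; split.
  apply/negP=> /vlineP [k /ffunP/(_ (inl y))].
  by rewrite !ffunE /GRing.scale /= inE (negbTE yX) !mulr0 mulr1; move: e0; lra.
apply/eqP => /ffunP/(_ (inl x)).
by rewrite !ffunE /GRing.scale /= xX mulr1; move: f0; lra.
Qed.

(** In the equation of neighbourhoods one inclusion keeps the minimality partners of vertices
    outside X on one side outside X; the other inclusion provides partners outside X on the opposite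
    side. *)
Lemma degenerate_covered : Qdeg mu X p ->
  covered (~: X) (tight mu (~: X) (col p) (row p)).
Proof.
case=> _ deg; have [Fp _] := rp; have Qp := face_Qmu Fp.
have tY s t : s \notin X -> t \notin X -> tightp p s t -> tight mu (~: X) (col p) (row p) s t.
  by move=> sX tX st; rewrite /tight !finset.in_setC sX tX.
have nr t : (inr t \in nbhd mu p (ccopy (~: X))) = [exists s, (s \notin X) && tightp p s t].
  rewrite inE; have -> : inr t \notin ccopy (~: X) by apply/negP=> /imsetP[].
  apply/existsP/existsP => -[].
    by move=> u /andP[/imsetP[s]]; rewrite inE => sX -> st; exists s; apply/andP.
  by move=> s /andP[sX st]; exists (inl s); apply/andP; split; [rewrite imset_f // inE | exact: st].
have nc s : (inl s \in nbhd mu p (rcopy (~: X))) = [exists t, (t \notin X) && tightp p s t].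
  rewrite inE; have -> : inl s \notin rcopy (~: X) by apply/negP=> /imsetP[].
  apply/existsP/existsP => -[].
    by move=> u /andP[/imsetP[t]]; rewrite inE => tX -> st; exists t; apply/andP.
  by move=> t /andP[tX st]; exists (inr t); apply/andP; split; [rewrite imset_f // inE | exact: st].
have rc t : (inr t \in rcopy (~: X)) = (t \notin X).
  by rewrite mem_imset ?inE // => ? ? [].
have cc s : (inl s \in ccopy (~: X)) = (s \notin X).
  by rewrite mem_imset ?inE // => ? ? [].
move=> s; rewrite finset.in_setC => sX.
have [[t|t] //= st] := Qmu_partner (inl s) Qp.
have [[u|u] //= us] := Qmu_partner (inr s) Qp.
case: deg => deg.
  split.
    exists t; apply: tY => //; rewrite -rc -deg nr; apply/existsP; exists s.
    by rewrite sX.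
  by move: (sX); rewrite -rc -deg nr => /existsP[v /andP[vX vs]]; exists v; apply: tY.
split.
  by move: (sX); rewrite -cc -deg nc => /existsP[v /andP[vX vs]]; exists v; apply: tY.
exists u; apply: tY => //; rewrite -cc -deg nc; apply/existsP; exists s.
by rewrite sX.
Qed.

Lemma nonfat_two_way : ~ fat_rel mu X p ->
  two_way (tight mu [set: S] (col p) (row p)).
Proof.
move=> nfat; have [Fp _] := rp.
have Xp : QmuX mu X p by apply: QmuX_loops.
have loopE s : tight mu [set: S] (col p) (row p) s s = (s \in X).
  by rewrite -tight_atE inE.
split.
  have /fintype.subsetPn [[v|v]] : ~~ (nbhd mu p (ccopy (~: X)) \subset rcopy (~: X)).
  - by apply/negP=> sub; apply: nfat; split=> //; left.
  - by rewrite inE => /andP[_ /existsP[u /andP[/imsetP[s _ ->]]]].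
  rewrite inE => /andP[_ /existsP[u /andP[/imsetP[s]]]].
  rewrite finset.in_setC => sX -> sv vX; exists s, v; rewrite !loopE -tight_atE; split=> //.
  by apply: contraNT vX => vX; rewrite imset_f // finset.in_setC.
have /fintype.subsetPn [[v|v]] : ~~ (nbhd mu p (rcopy (~: X)) \subset ccopy (~: X)).
- by apply/negP=> sub; apply: nfat; split=> //; right.
- rewrite inE => /andP[_ /existsP[u /andP[/imsetP[s]]]].
  rewrite finset.in_setC => sX -> sv vX; exists v, s; rewrite !loopE -tight_atE; split=> //.
  by apply: contraNT vX => vX; rewrite imset_f // finset.in_setC.
by rewrite inE => /andP[_ /existsP[u /andP[/imsetP[s _ ->]]]].
Qed.

(** The loops form a complete bipartite block, tied to a row outside X. A direction vanishing on the
    rows outside X therefore vanishes on the block, and then everywhere. *)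
Lemma nonfat_directions (V : {vspace point}) v :
    two_way (tight mu [set: S] (col p) (row p)) ->
    (forall u, u \in V -> pres p u) -> v \in V -> (exists z, v z != 0) ->
  exists2 s, s \in ~: X & v (inl s) != 0.
Proof.
move=> [[a [x [aa xx ax]]] _] Vp vV [z vz]; have [Fp _] := rp.
have loopE s : tight mu [set: S] (col p) (row p) s s = (s \in X).
  by rewrite -tight_atE inE.
rewrite !loopE in aa xx; rewrite -tight_atE in ax.
have [s vs] : exists s, v (inl s) != 0.
  case: z vz => [s|t] vz; first by exists s.
  have [[s|s] //= st] := Qmu_partner (inr t) (face_Qmu Fp).
  by exists s; apply: contraNN vz => /eqP v0; have := Vp _ vV _ _ st; rewrite v0 add0r => ->.
have [sX|sX] := boolP (s \in X); last by exists s; rewrite ?finset.in_setC.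
exists a; rewrite ?finset.in_setC //; apply: contraNN vs => /eqP va.
have := Vp _ vV _ _ ax; rewrite va add0r => vx.
by have := Vp _ vV _ _ (loops_tight sX xx); rewrite vx addr0 => ->.
Qed.

Lemma degenerate_line v : Qdeg mu X p -> pres p v ->
  (forall s, s \notin X -> v (inl s) = 0) -> v \in <[shift R X]>%VS.
Proof.
move=> deg pv v0; apply/vlineP.
have vr t : t \notin X -> v (inr t) = 0.
  move=> tX; have [|_ [s]] := degenerate_covered deg (s := t); first by rewrite finset.in_setC.
  rewrite (tight_restrict _ _ _ _ _ (finset.subsetT (~: X))) -tight_atE => /and3P[st].
  by rewrite finset.in_setC => /v0 vs _; have := pv _ _ st; rewrite vs add0r.
(* On the complete block over X the direction is constant up to sign. For empty X both sides are
   zero and the coefficient is arbitrary. *)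
exists (if [pick x in X] is Some x then v (inl x) else 0).
case: pickP => [x xX|X0]; apply/ffunP=> -[s|s]; rewrite !ffunE /GRing.scale /=.
- have [sX|sX] := boolP (s \in X); last by rewrite mulr0 v0.
  have := pv _ _ (loops_tight sX xX); have := pv _ _ (loops_tight xX xX).
  by rewrite mulr1; lra.
- have [sX|sX] := boolP (s \in X); last by rewrite oppr0 mulr0 vr.
  by have := pv _ _ (loops_tight xX sX); rewrite mulrN1; lra.
- by rewrite mul0r v0 // X0.
- by rewrite mul0r vr // X0.
Qed.

(* If [shift R X] preserves the tight pairs, then it is lost as a direction, but
   [slim_class] is a plane and the face has one dimension more. *)
Lemma degenerate_directions : Qdeg mu X p -> (2 + affdim slim_class <= affdim F)%N ->
    (1 <= affdim slim_class)%N ->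
  exists V : {vspace point}, [/\ (3 <= \dim V)%N, forall u, u \in V -> pres p u &
    forall v, v \in V -> (exists z, v z != 0) -> exists2 s, s \in ~: X & v (inl s) != 0].
Proof.
move=> deg dF d1; pose L := <[shift R X]>%VS.
have dL : (\dim L <= 1)%N by rewrite dim_vline leq_b1.
have key (V : {vspace point}) : (forall u, u \in V -> pres p u) -> (V :&: L = 0)%VS ->
    forall v, v \in V -> (exists z, v z != 0) -> exists2 s, s \in ~: X & v (inl s) != 0.
  move=> Vp VL v vV [z vz]; apply: contrapT => H.
  have : v \in (V :&: L)%VS.
    rewrite memv_cap vV; apply: degenerate_line => //; first exact: Vp.
    by move=> s sX; apply/eqP/negPn/negP=> vs; apply: H; exists s; rewrite ?finset.in_setC.
  by rewrite VL memv0 => /eqP v0; rewrite v0 ffunE eqxx in vz.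
have [d2|d2] := leqP 2 (affdim slim_class).
  (* A complement of the line L costs at most one dimension, so four are needed here. *)
  have [|V [V4 Vp]] := @face_directions 4 isT; first by apply: leq_trans dF; lia.
  exists (V :\: L)%VS; split.
  - have := dimv_cap_compl V L; have := leq_trans (dimvS (capvSr V L)) dL.
    by move: V4; set a := \dim _; set b := \dim (V :&: L); set c := \dim (V :\: L); lia.
  - by move=> u /(subvP (diffvSl V L)); apply: Vp.
  - by apply: key; [move=> u /(subvP (diffvSl V L)); apply: Vp | exact: capv_diff].
have [|V [V3 Vp]] := @face_directions 3 isT; first by apply: leq_trans dF; lia.
exists V; split=> //; apply: key => //; apply/eqP; rewrite -vpick0.
set v := vpick _; have : v \in (V :&: L)%VS := memv_pick _.
rewrite memv_cap => /andP[vV /vlineP[k vE]]; apply/negPn/negP => v0.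
have k0 : k != 0 by apply: contraNneq v0 => k0; rewrite vE k0 scale0r.
have pX : pres p (shift R X).
  have -> : shift R X = k^-1 *: v by rewrite vE scalerA mulVf // scale1r.
  by apply: Vp; apply: memvZ.
have [x xX] : exists x, x \in X.
  apply/finset.set0Pn; apply: contraNneq v0 => X0; rewrite vE X0.
  suff -> : shift R (finset.set0 : {set S}) = 0 by rewrite scaler0.
  by apply/ffunP=> -[s|s]; rewrite !ffunE inE ?oppr0.
have [y yX] : exists y, y \notin X.
  apply: contrapT => nY; suff : (V <= L)%VS.
    by move/dimvS => dVL; have := leq_trans V3 (leq_trans dVL dL).
  apply/subvP=> u uV; apply: degenerate_line => //; first exact: Vp.
  by move=> s sX; case: nY; exists s.
by have := slim_class_dim2 xX yX deg pX; rewrite leqNgt d2.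
Qed.

(** A degenerate p lets all loops be dropped at once, with [U] the complement of X. Otherwise p is
    not fat, and [U] is all of S with [two_way]. *)
Lemma face_certificate : (2 + affdim slim_class <= affdim F)%N ->
  exists (U : {set S}) (e := tight mu U (col p) (row p)) (s : 'I_3 -> S),
    [/\ feasible mu U (col p) (row p), covered U e, two_way e \/ loopless e,
        (forall i, s i \in U) /\ (forall i, ~~ e (s i) (s i)) &
        forall i j, i != j -> apart e (s i) (s j)].
Proof.
move=> dF; have [Fp _] := rp; have [Pp _] := face_Qmu Fp; case: hmu => mu0 mud.
have feas U : feasible mu U (col p) (row p) by move=> s t _ _; apply: Pp.
have d1 : (1 <= affdim slim_class)%N.
  have [|V [V1 _]] := @face_directions 1 isT; first by apply: leq_trans dF.
  by have [v _ [[s|s] _]] := dim_nonzero V1; apply: slim_class_dim1.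
have [deg|ndeg] := pselect (Qdeg mu X p).
  have [V [V3 Vp VY]] := degenerate_directions deg dF d1.
  have [|s [sY sA]] := @separated_triple V (~: X) (tight mu (~: X) (col p) (row p)) V3 _ VY.
    by move=> v s t vV /and3P[_ _ st]; apply: (Vp v).
  exists (~: X), s; split=> //; first exact: degenerate_covered.
    right=> t; apply/negP=> /and3P[tX _ tt]; move: tX.
    by rewrite finset.in_setC inE => /negP; apply.
  split=> // i; apply/negP=> /and3P[tX _ tt]; move: tX.
  by rewrite finset.in_setC inE => /negP; apply.
have nfat : ~ fat_rel mu X p.
  move=> fat; case: (slim Fp) => _; apply; split.
    by exists X; split=> //; apply: loops_zero_family.
  (* Membership in [QmuX] determines the set: it consists of the loops of p. *)
  case=> Z [_ degZ]; apply: ndeg; suff <- : Z = X by [].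
  by apply/setP=> s; rewrite inE; case: degZ => -[_ ZE] _; rewrite -ZE.
have tw := nonfat_two_way nfat.
have [|V [V3 Vp]] := @face_directions 3 isT; first by apply: leq_trans dF; lia.
have [||s [sY sA]] := @separated_triple V (~: X) (tight mu [set: S] (col p) (row p)) V3.
- by move=> v s t vV; rewrite -tight_atE; apply: (Vp v).
- by move=> v; apply: nonfat_directions.
exists [set: S], s; split=> //; last by split=> // i; have := sY i; rewrite finset.in_setC inE tight_atE.
- move=> t _; have Qp := face_Qmu Fp; split.
    by have [[u|u] //= tu] := Qmu_partner (inl t) Qp; exists u; rewrite -tight_atE.
  by have [[u|u] //= tu] := Qmu_partner (inr t) Qp; exists u; rewrite -tight_atE.
- by left.
Qed.

End Face.

Lemma slim_certificate : (2 <= dim_Qslim_bar mu)%N ->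
  exists (c r : S -> R) (x y : 'I_3 -> S) (w : S -> S -> nat),
    [/\ [/\ forall s t, mu s t <= c s + r t, forall s, 0 <= c s,
            forall s, 0 <= r s & forall s, 0 < c s + r s],
        forall i j, (c (x i) + r (y j) == mu (x i) (y j)) = (i == j),
        forall s t, (0 < w s t)%N -> c s + r t = mu s t,
        balanced w & forall i, (0 < w (x i) (y i))%N].
Proof.
rewrite /dim_Qslim_bar => dQ; case: (hmu) => mu0 mud.
have [d d2 [F [face slim [p [rp dE]]]]] := bigmax_ord_witness (ltn0Sn 1) dQ.
have [|U [s [feas cov tw [sU sl] sA]]] := @face_certificate F p face slim rp.
  (* The truncated subtraction is harmless, since its value is at least 2. *)
  by move: d2; rewrite dE /slim_class; lia.
exact: (circulation_certificate mu0 mud feas cov tw sU sl sA).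
Qed.

End Slim.

(** * Multiflows and complementary slackness *)

Section Arcs.
Variable V : finType.
Implicit Types (x y z : V) (q p : seq V).

Lemma sum_mem (R : pzSemiRingType) (T : finType) (s : seq T) (F : T -> R) : uniq s ->
  \sum_i (i \in s)%:R * F i = \sum_(i <- s) F i.
Proof.
move=> us; rewrite [RHS]big_uniq //= [RHS]big_mkcond; apply: eq_bigr => i _.
by case: (i \in s); rewrite ?mul1r ?mul0r.
Qed.

Lemma uniq_arcs p : uniq p -> uniq (zip p (behead p)).
Proof. exact: zip_uniql. Qed.

Lemma mem_zip (A B : eqType) (s : seq A) (t : seq B) a b :
  (a, b) \in zip s t -> (a \in s) && (b \in t).
Proof.
elim: s t => [|a' s IHs] [|b' t] //=; rewrite !inE xpair_eqE.
case/orP => [/andP[-> ->] //|/IHs/andP[-> ->]].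
by rewrite !orbT.
Qed.

Lemma arcs_fst x q z : uniq (x :: q) ->
  (\sum_y ((z, y) \in zip (x :: q) q) = (z \in belast x q))%N.
Proof.
elim: q x => [|w q IHq] x; first by rewrite big1.
rewrite cons_uniq => /andP[xq uq] /=; rewrite inE.
under eq_bigr do rewrite inE xpair_eqE.
have [->|zx] /= := eqVneq z x.
  rewrite (bigD1 w) //= eqxx big1 ?addn0 // => y /negbTE -> /=.
  by apply/eqP; rewrite eqb0; apply: contra xq => /mem_zip/andP[].
exact: IHq.
Qed.

Lemma arcs_snd x q z : uniq (x :: q) ->
  (\sum_y ((y, z) \in zip (x :: q) q) = (z \in q))%N.
Proof.
elim: q x => [|w q IHq] x; first by rewrite big1.
rewrite cons_uniq => /andP[xq uq] /=; rewrite inE.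
under eq_bigr do rewrite inE xpair_eqE.
have [->|zw] /= := eqVneq z w.
  rewrite (bigD1 x) //= eqxx big1 /= ?addn0 // => y /negbTE -> /=.
  apply/eqP; rewrite eqb0; case/andP: uq => wq _; apply: contra wq => /mem_zip.
  by case/andP.
under eq_bigr do rewrite andbF.
exact: IHq.
Qed.

Lemma arcs_sum (R : nmodType) x q (lo li : V -> R) :
  \sum_(a <- zip (x :: q) q) (lo a.1 + li a.2) =
  \sum_(z <- belast x q) lo z + \sum_(z <- q) li z.
Proof.
elim: q x => [|w q IHq] x; first by rewrite !big_nil addr0.
by rewrite /= !big_cons IHq /= addrACA.
Qed.

End Arcs.

Section Duality.
Variables (R : realType) (S W : finType) (mu : S -> S -> R).
Variable cp : S + W -> S + W -> nat.

Lemma inl_injective : injective (@inl S W).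
Proof. by move=> s t []. Qed.

(* Absent edges are edges of capacity zero. *)
Definition net : network S :=
  @Network S (S + W)%type (fun _ _ => true) cp inl inl_injective.

Local Notation V := (S + W)%type.

Variables (c r : S -> R).
Hypotheses (mu_le : forall s t, mu s t <= c s + r t)
  (c_ge0 : forall s, 0 <= c s) (r_ge0 : forall s, 0 <= r s)
  (cr_gt0 : forall s, 0 < c s + r s).

(** The dual solution: arcs leaving s are charged [c s], arcs entering t are charged [r t], and arcs
    inside W are free. [capacity_length] is its objective value. *)
Definition out_length (x : V) : R := if x is inl s then c s else 0.
Definition in_length (x : V) : R := if x is inl t then r t else 0.
Definition arc_length (x y : V) : R := out_length x + in_length y.
Definition capacity_length : R := \sum_x \sum_y (cp x y)%:R * arc_length x y.

Lemma out_length_ge0 x : 0 <= out_length x. Proof. by case: x. Qed.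
Lemma in_length_ge0 x : 0 <= in_length x. Proof. by case: x. Qed.
Lemma arc_length_ge0 x y : 0 <= arc_length x y.
Proof. by rewrite addr_ge0 ?out_length_ge0 ?in_length_ge0. Qed.

Definition path_length (q : seq V) : R :=
  \sum_(a <- zip q (behead q)) arc_length a.1 a.2.

Lemma joins_ends s t q : s != t -> joins (N := net) s t q ->
  uniq q /\ exists m, q = inl s :: rcons m (inl t).
Proof.
move=> st; case: q => // x q /and4P[/eqP -> /eqP lq _ uq]; split=> //.
case/lastP: q lq uq => [[ts]|m y]; first by rewrite ts eqxx in st.
by rewrite last_rcons => -> _; exists m.
Qed.

Lemma path_length_joins s t m :
  path_length (inl s :: rcons m (inl t)) =
  c s + r t + \sum_(z <- m) (out_length z + in_length z).
Proof.
rewrite /path_length /= arcs_sum belast_rcons big_cons big_rcons /=.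
by rewrite big_split /=; ring.
Qed.

Lemma path_length_ge s t q : s != t -> joins (N := net) s t q ->
  mu s t <= path_length q.
Proof.
move=> st /(joins_ends st)[_ [m ->]]; rewrite path_length_joins.
apply: le_trans (mu_le s t) _; rewrite lerDl sumr_ge0 // => z _.
by rewrite addr_ge0 ?out_length_ge0 ?in_length_ge0.
Qed.

(** A terminal u in the interior of the path would add [c u + r u > 0] to the length. *)
Lemma path_length_tight s t q : s != t -> joins (N := net) s t q ->
    path_length q = mu s t ->
  c s + r t = mu s t /\ exists ws : seq W, q = inl s :: rcons (map inr ws) (inl t).
Proof.
move=> st /(joins_ends st)[_ [m ->]]; rewrite path_length_joins => E.
have m0 z : 0 <= out_length z + in_length z.
  by rewrite addr_ge0 ?out_length_ge0 ?in_length_ge0.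
have sm0 : 0 <= \sum_(z <- m) (out_length z + in_length z) by apply: sumr_ge0.
have sm : \sum_(z <- m) (out_length z + in_length z) = 0.
  by apply/le_anti; rewrite sm0 andbT; have := mu_le s t; lra.
split; first by rewrite -E sm addr0.
have : all (fun z => out_length z + in_length z == 0) m.
  by move: sm => /eqP; rewrite psumr_eq0 // => z _; apply: m0.
elim: m {E sm0 sm} => [|z m IHm] /=; first by exists [::].
case/andP=> z0 /IHm [ws [wsE]]; case: z z0 => [u|w] /=; last first.
  by exists (w :: ws); rewrite /= wsE.
by rewrite gt_eqF.
Qed.

Lemma mu_value_joins s t q : joins (N := net) s t q ->
  \sum_(st : S * S | joins (N := net) st.1 st.2 q) mu st.1 st.2 = mu s t.
Proof.
move=> jq; rewrite (big_pred1 (s, t)) // => -[s' t'] /=.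
case: q jq => // x q /and3P[/eqP -> /eqP lq H]; rewrite /= lq H andbT.
by rewrite /= xpair_eqE eq_sym; congr andb; rewrite eq_sym.
Qed.

Definition load (P : {fset seq V}) (lam : seq V -> R) (x y : V) : R :=
  \sum_(q <- P) lam q * (traverses (N := net) q x y)%:R.

Lemma load_traverses (P : {fset seq V}) (lam : seq V -> R) x y :
  \sum_(q <- P | traverses (N := net) q x y) lam q = load P lam x y.
Proof.
rewrite big_mkcond; apply: eq_bigr => q _.
by case: traverses; rewrite ?mulr1 ?mulr0.
Qed.

(** Complementary slackness: the gap between the objectives is a sum of terms weight times (path
    length minus value) and (capacity minus load) times arc length. All are nonnegative, so all
    vanish. *)
Lemma tight_multiflow (P : {fset seq V}) (lam : seq V -> R) :
    multiflow (N := net) P lam -> capacity_length <= mu_value mu (N := net) P lam ->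
  (forall q, q \in P -> lam q != 0 -> exists s t (ws : seq W),
    [/\ joins (N := net) s t q, q = inl s :: rcons (map inr ws) (inl t) & c s + r t = mu s t]) /\
  (forall x y, 0 < arc_length x y -> load P lam x y = (cp x y)%:R).
Proof.
case=> Pt P0 Pc cl.
have ld x y : load P lam x y <= (cp x y)%:R by rewrite -load_traverses; apply: Pc.
have ends q : q \in P -> exists s t, [/\ s != t, joins (N := net) s t q & uniq q].
  by case/Pt=> s [t [st jq]]; exists s, t; split=> //; have [] := joins_ends st jq.
pose val q := \sum_(st : S * S | joins (N := net) st.1 st.2 q) mu st.1 st.2.
have len q : q \in P -> path_length q =
    \sum_x \sum_y (traverses (N := net) q x y)%:R * arc_length x y.
  case/ends=> s [t [_ _ uq]]; rewrite pair_big /=.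
  apply: etrans (esym (sum_mem (fun a => arc_length a.1 a.2) (uniq_arcs uq))) _.
  by apply: eq_bigr => -[x y] _.
have lenE : \sum_(q <- P) lam q * path_length q =
    \sum_x \sum_y load P lam x y * arc_length x y.
  rewrite /load; under [RHS]eq_bigr => x _ do
    under eq_bigr => y _ do rewrite mulr_suml.
  under [RHS]eq_bigr => x _ do rewrite exchange_big.
  rewrite exchange_big; apply: eq_big_seq => q /len ->.
  rewrite mulr_sumr; apply: eq_bigr => x _.
  by rewrite mulr_sumr; apply: eq_bigr => y _; rewrite mulrA.
have gap1 q : q \in P -> 0 <= lam q * (path_length q - val q).
  move=> qP; have [s [t [st jq _]]] := ends _ qP.
  by rewrite mulr_ge0 ?P0 // subr_ge0 /val (mu_value_joins jq) path_length_ge.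
have gap2 x y : 0 <= ((cp x y)%:R - load P lam x y) * arc_length x y.
  by rewrite mulr_ge0 ?arc_length_ge0 // subr_ge0 ld.
have sum0 : \sum_(q <- P) lam q * (path_length q - val q) +
    \sum_x \sum_y ((cp x y)%:R - load P lam x y) * arc_length x y <= 0.
  have -> : \sum_x \sum_y ((cp x y)%:R - load P lam x y) * arc_length x y =
      capacity_length - \sum_(q <- P) lam q * path_length q.
    rewrite lenE /capacity_length -sumrB; apply: eq_bigr => x _.
    by rewrite -sumrB; apply: eq_bigr => y _; rewrite mulrBl.
  under eq_bigr do rewrite mulrBr; rewrite sumrB.
  by move: cl; rewrite /mu_value -/val; lra.
have s1 : 0 <= \sum_(q <- P) lam q * (path_length q - val q).
  by rewrite big_seq; apply: sumr_ge0.
have s2 : 0 <= \sum_x \sum_y ((cp x y)%:R - load P lam x y) * arc_length x y.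
  by do 2!apply: sumr_ge0 => ? _.
split=> [q qP lq|x y l0].
  have : \sum_(q <- P) lam q * (path_length q - val q) == 0.
    by apply/eqP/le_anti; rewrite s1 andbT; move: sum0 s2; lra.
  rewrite big_seq psumr_eq0 // => /allP/(_ q qP); rewrite qP /= mulf_eq0 (negbTE lq) /=.
  have [s [t [st jq _]]] := ends _ qP; rewrite /val (mu_value_joins jq) subr_eq0 => /eqP E.
  by have [T [ws qE]] := path_length_tight st jq E; exists s, t, ws.
have : \sum_x \sum_y ((cp x y)%:R - load P lam x y) * arc_length x y == 0.
  by apply/eqP/le_anti; rewrite s2 andbT; move: sum0 s1; lra.
rewrite pair_big /= psumr_eq0 => [/allP/(_ (x, y))|[? ?] _]; last exact: gap2.
rewrite mem_index_enum /= => /(_ isT); rewrite mulf_eq0 (gt_eqF l0) orbF subr_eq0.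
by move/eqP.
Qed.

(** Passes from indexed families to sets of paths: weights of equal paths are added up, and indices
    of weight zero, whose sequences need not be paths, are discarded. *)
Lemma optimum_ge_family (J : finType) (pa : J -> seq V) (wt : J -> R)
    (src tgt : J -> S) (P : {fset seq V}) (lam : seq V -> R) :
    optimal_multiflow mu (N := net) P lam ->
    (forall j, 0 <= wt j) ->
    (forall j, wt j != 0 -> src j != tgt j /\ joins (N := net) (src j) (tgt j) (pa j)) ->
    (forall x y, \sum_j wt j * (traverses (N := net) (pa j) x y)%:R <= (cp x y)%:R) ->
  \sum_j wt j * mu (src j) (tgt j) <= mu_value mu (N := net) P lam.
Proof.
case=> _ opt wt0 jn cap.
pose P' : {fset seq V} := [fset pa j | j in J & wt j != 0]%fset.
pose lam' q := \sum_(j | pa j == q) wt j.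
have regroup (f : seq V -> R) :
    \sum_(q <- P') lam' q * f q = \sum_j wt j * f (pa j).
  rewrite /lam'; under eq_bigr => q _ do rewrite mulr_suml big_mkcond.
  rewrite exchange_big; apply: eq_bigr => j _ /=.
  have [w0|wn] := eqVneq (wt j) 0.
    by rewrite w0 mul0r big1 // => q _; case: (pa j == q); rewrite ?w0 ?mul0r.
  rewrite (big_fsetD1 (pa j)) /=; last by apply/imfsetP; exists j.
  rewrite eqxx big_seq big1 ?addr0 // => q.
  by rewrite in_fsetD1 eq_sym => /andP[/negbTE ->].
have <- : mu_value mu (N := net) P' lam' = \sum_j wt j * mu (src j) (tgt j).
  rewrite /mu_value regroup; apply: eq_bigr => j _.
  have [->|/jn[_ jq]] := eqVneq (wt j) 0; first by rewrite !mul0r.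
  by rewrite (mu_value_joins jq).
apply: opt; split.
- move=> q /imfsetP[j /= wj ->]; rewrite inE /= in wj; have [st jq] := jn j wj.
  by exists (src j), (tgt j).
- by move=> q _; apply: sumr_ge0.
- move=> x y _; rewrite load_traverses /load regroup; exact: cap.
Qed.

(** * Flow of a single commodity *)

Section Commodity.
Variables (P : {fset seq V}) (lam : seq V -> R).
Hypotheses (Pflow : multiflow (N := net) P lam)
  (Ptight : forall q, q \in P -> lam q != 0 -> exists s t (ws : seq W),
    [/\ joins (N := net) s t q, q = inl s :: rcons (map inr ws) (inl t) & c s + r t = mu s t]).

(* [2 < size q] excludes the direct edge from [s0] to [t0]. *)
Definition flow (s0 t0 : S) (x y : V) : R :=
  \sum_(q <- P | joins (N := net) s0 t0 q && (2 < size q)%N)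
    lam q * (traverses (N := net) q x y)%:R.

Lemma lam_ge0 q : q \in P -> 0 <= lam q.
Proof. by case: Pflow => _ + _; apply. Qed.

Lemma flow_ge0 s0 t0 x y : 0 <= flow s0 t0 x y.
Proof.
by rewrite /flow big_seq_cond; apply: sumr_ge0 => q /andP[/lam_ge0 ? _]; rewrite mulr_ge0.
Qed.

Lemma joins_inj s t s' t' q :
  joins (N := net) s t q -> joins (N := net) s' t' q -> s = s' /\ t = t'.
Proof.
case: q => // x q /and3P[/eqP xs /eqP lt _] /and3P[/eqP xs' /eqP lt' _].
by split; apply: inl_injective; [apply: etrans (esym xs) xs' | apply: etrans (esym lt) lt'].
Qed.

Lemma load_le x y : load P lam x y <= (cp x y)%:R.
Proof. by case: Pflow => _ _ Pc; rewrite -load_traverses; apply: Pc. Qed.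

Lemma cap_gt0 q x y : q \in P -> lam q != 0 -> traverses (N := net) q x y -> (0 < cp x y)%N.
Proof.
move=> qP lq qxy; rewrite -(ltr_nat R); apply: lt_le_trans (load_le x y).
rewrite /load (big_fsetD1 q) //= qxy mulr1; apply: ltr_wpDr.
  by rewrite big_seq; apply: sumr_ge0 => z; rewrite in_fsetD1 => /andP[_ /lam_ge0 ?]; rewrite mulr_ge0.
by rewrite lt_neqAle eq_sym lq lam_ge0.
Qed.

Lemma flow_conserve s0 t0 v : s0 != t0 ->
  \sum_x flow s0 t0 x (inr v) = \sum_y flow s0 t0 (inr v) y.
Proof.
move=> st; rewrite /flow exchange_big [RHS]exchange_big /=.
apply: eq_bigr => q /andP[jq _]; have [uq [m qE]] := joins_ends st jq.
rewrite -!mulr_sumr -!natr_sum /traverses {}qE in uq *; rewrite /= in uq *.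
rewrite (arcs_fst (inr v) uq) (arcs_snd (inr v) uq) belast_rcons.
by rewrite mem_rcons !inE.
Qed.

Lemma arcs_inl_fst s t s' (ws : seq W) (y : V) (m := rcons (map inr ws) (inl t) : seq V) :
  (inl s' : V, y) \in zip (inl s :: m) m ->
  s' = s.
Proof.
move=> H; have {H} : (inl s' : V) \in belast (inl s) (rcons (map inr ws) (inl t)).
  move: H; rewrite {}/m; elim: (rcons _ _) (inl s : V) => //= w q IHq x; rewrite !inE xpair_eqE.
  by case/orP => [/andP[-> //]|/IHq ->]; rewrite orbT.
by rewrite belast_rcons inE => /orP[/eqP [] //|/mapP[]].
Qed.

Lemma arcs_inl_snd s t t' (ws : seq W) (x : V) (m := rcons (map inr ws) (inl t) : seq V) :
  (x, inl t' : V) \in zip (inl s :: m) m ->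
  t' = t.
Proof.
by move/mem_zip/andP=> [_]; rewrite mem_rcons inE => /orP[/eqP [] //|/mapP[]].
Qed.

Lemma flow_src s0 t0 s y : s != s0 -> flow s0 t0 (inl s) y = 0.
Proof.
move=> ss0; rewrite /flow big_seq_cond big1 // => q /and3P[qP jq _].
have [->|lq] := eqVneq (lam q) 0; first by rewrite mul0r.
have [s' [t' [ws [jq' qE _]]]] := Ptight qP lq; have [Es _] := joins_inj jq jq'.
case tr: traverses; last by rewrite mulr0.
move: tr; rewrite /traverses qE => /arcs_inl_fst E.
by rewrite E -Es eqxx in ss0.
Qed.

Lemma flow_tgt s0 t0 x t : t != t0 -> flow s0 t0 x (inl t) = 0.
Proof.
move=> tt0; rewrite /flow big_seq_cond big1 // => q /and3P[qP jq _].
have [->|lq] := eqVneq (lam q) 0; first by rewrite mul0r.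
have [s' [t' [ws [jq' qE _]]]] := Ptight qP lq; have [_ Et] := joins_inj jq jq'.
case tr: traverses; last by rewrite mulr0.
move: tr; rewrite /traverses qE => /arcs_inl_snd E.
by rewrite E -Et eqxx in tt0.
Qed.

Lemma flow_conserve_core s0 t0 v : s0 != t0 ->
  flow s0 t0 (inl s0) (inr v) + \sum_u flow s0 t0 (inr u) (inr v) =
  flow s0 t0 (inr v) (inl t0) + \sum_u flow s0 t0 (inr v) (inr u).
Proof.
move=> st; have := flow_conserve v st; rewrite !big_sumType /=.
have -> : \sum_s flow s0 t0 (inl s) (inr v) = flow s0 t0 (inl s0) (inr v).
  by rewrite (bigD1 s0) //= big1 ?addr0 // => s; apply: flow_src.
suff -> : \sum_t flow s0 t0 (inr v) (inl t) = flow s0 t0 (inr v) (inl t0) by [].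
by rewrite (bigD1 t0) //= big1 ?addr0 // => t; apply: flow_tgt.
Qed.

Lemma flow_add_le s0 t0 s1 t1 x y : s0 != s1 ->
  flow s0 t0 x y + flow s1 t1 x y <= (cp x y)%:R.
Proof.
move=> ss; apply: le_trans (load_le x y).
rewrite /flow /load [X in X + _]big_mkcond [X in _ + X]big_mkcond -big_split /=.
rewrite big_seq [leRHS]big_seq; apply: ler_sum => q qP.
have q0 : 0 <= lam q * (traverses (N := net) q x y)%:R by rewrite mulr_ge0 ?lam_ge0.
case: ifP => [/andP[j0 _]|_]; case: ifP => [/andP[j1 _]|_]; rewrite ?addr0 ?add0r //.
by have [E _] := joins_inj j0 j1; rewrite E eqxx in ss.
Qed.

(** A path of nonzero weight from s0 into the core leaves the core directly into its end, which is
    tight with s0; the hypothesis identifies this end as t0. *)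
Lemma flow_src_load s0 t0 v :
    (forall u t, (0 < cp (inr u) (inl t))%N -> c s0 + r t = mu s0 t -> t = t0) ->
  flow s0 t0 (inl s0) (inr v) = load P lam (inl s0) (inr v).
Proof.
move=> H; rewrite /flow /load big_mkcond; apply: eq_big_seq => q qP.
case: ifP => //; have [->|lq] := eqVneq (lam q) 0; first by rewrite mul0r.
have [s [t [ws [jq qE st]]]] := Ptight qP lq.
case tr: traverses; last by rewrite mulr0.
have Es : s0 = s by move: tr; rewrite /traverses qE => /arcs_inl_fst.
have ws0 : ws != [::].
  by apply/eqP=> ws0; move: tr; rewrite /traverses qE ws0 /= inE => /eqP [].
have [ws' [w wsE]] : exists ws' w, ws = rcons ws' w.
  by case/lastP: ws ws0 {qE} => // ws' w _; exists ws', w.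
have Et : t = t0.
  apply: (H w); last by rewrite Es.
  apply: (cap_gt0 qP lq); rewrite /traverses qE wsE map_rcons.
  have zip_last (x a b : V) m : (a, b) \in zip (x :: rcons (rcons m a) b) (rcons (rcons m a) b).
    elim: m x => [|d m IHm] x /=; rewrite !inE ?eqxx ?orbT //.
    by rewrite IHm orbT.
  exact: zip_last.
by rewrite Es -Et jq qE wsE /= size_rcons size_map size_rcons.
Qed.

Lemma flow_tgt_load s0 t0 v :
    (forall s u, (0 < cp (inl s) (inr u))%N -> c s + r t0 = mu s t0 -> s = s0) ->
  flow s0 t0 (inr v) (inl t0) = load P lam (inr v) (inl t0).
Proof.
move=> H; rewrite /flow /load big_mkcond; apply: eq_big_seq => q qP.
case: ifP => //; have [->|lq] := eqVneq (lam q) 0; first by rewrite mul0r.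
have [s [t [ws [jq qE st]]]] := Ptight qP lq.
case tr: traverses; last by rewrite mulr0.
have Et : t0 = t by move: tr; rewrite /traverses qE => /arcs_inl_snd.
have [w [ws' wsE]] : exists w ws', ws = w :: ws'.
  case: ws {jq} qE => [|w ws'] qE; last by exists w, ws'.
  by move: tr; rewrite /traverses qE /= inE => /eqP [].
have Es : s = s0.
  apply: (H _ w); last by rewrite Et.
  by apply: (cap_gt0 qP lq); rewrite /traverses qE wsE /= inE eqxx.
by rewrite Et -Es jq qE wsE /= size_rcons.
Qed.

Lemma flow_int k s0 t0 x y : fractionally_integral (N := net) k P lam ->
  k%:R * flow s0 t0 x y \is a Num.int.
Proof.
move=> Pk; rewrite /flow mulr_sumr big_seq_cond; apply: rpred_sum => q /andP[qP _].
by rewrite mulrA rpredM ?Pk ?natr_int ?intr_nat ?rpred_nat ?Pk //.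
Qed.

End Commodity.

End Duality.

(** * The core *)

(* Commodity A enters at [SA] (one unit) and [SR] (k units) and leaves at [TT];
   commodity B enters at [SB i] and [SC i] (one unit each) and leaves at [TB] and
   [TC].  In lane i the arcs from [Bt], [Et], [Ht], [Dt] to [Bh], [Eh], [Hh], [Dh]
   have capacity one and are used by both commodities.  Let z i be the flow of A
   on [Bt i].  B fills the rest of this arc, hence z i of [Et i], and A sends 1 - z i
   through [Et i] and then [Ht i].  So at most z i of the unit of [SC i] passes
   through [Ht i], and at least 1 - z i through [Dt i], which A enters with
   z (i - 1).  Thus z (i - 1) <= z i for all i in cyclic order. *)
Inductive hub := SA | SR | TT | TB | TC.
Inductive stage := SB | SC | Bt | Bh | Et | Eh | Ht | Hh | Dt | Dh.

Definition hub_code (h : hub) : nat :=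
  match h with SA => 0 | SR => 1 | TT => 2 | TB => 3 | TC => 4 end.
Definition hub_decode (n : nat) : option hub := nth None (map some [:: SA; SR; TT; TB; TC]) n.
Lemma hub_codeK : pcancel hub_code hub_decode. Proof. by case. Qed.
HB.instance Definition _ := Countable.copy hub (pcan_type hub_codeK).
Lemma hub_enumP : Finite.axiom [:: SA; SR; TT; TB; TC]. Proof. by case. Qed.
HB.instance Definition _ := isFinite.Build hub hub_enumP.

Definition stage_code (s : stage) : nat :=
  match s with SB => 0 | SC => 1 | Bt => 2 | Bh => 3 | Et => 4 | Eh => 5
             | Ht => 6 | Hh => 7 | Dt => 8 | Dh => 9 end.
Definition stage_decode (n : nat) : option stage :=
  nth None (map some [:: SB; SC; Bt; Bh; Et; Eh; Ht; Hh; Dt; Dh]) n.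
Lemma stage_codeK : pcancel stage_code stage_decode. Proof. by case. Qed.
HB.instance Definition _ := Countable.copy stage (pcan_type stage_codeK).
Lemma stage_enumP : Finite.axiom [:: SB; SC; Bt; Bh; Et; Eh; Ht; Hh; Dt; Dh].
Proof. by case. Qed.
HB.instance Definition _ := isFinite.Build stage stage_enumP.

Section Core.
Variable k : nat.
Local Notation lane := 'I_k.+1.
Local Notation core := (hub + stage * lane)%type.
Local Notation H h := (inl h : core).
Local Notation L s i := (inr (s, i) : core).

Definition shared (u v : core) : bool :=
  match u, v with
  | inr (Bt, i), inr (Bh, j) | inr (Et, i), inr (Eh, j)
  | inr (Ht, i), inr (Hh, j) | inr (Dt, i), inr (Dh, j) => i == j
  | _, _ => false
  end.

Definition unshared (u v : core) : bool :=
  match u, v with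
  | inl SA, inr (Bt, _) | inl SR, inr (Et, _) => true
  | inr (SB, i), inr (Bt, j) | inr (SB, i), inr (Et, j)
  | inr (SC, i), inr (Ht, j) | inr (SC, i), inr (Dt, j)
  | inr (Eh, i), inr (Ht, j) => i == j
  | inr (Bh, i), inr (Dt, j) => ordS i == j
  | inr (Bh, _), inl TB | inr (Eh, _), inl TC
  | inr (Hh, _), inl TT | inr (Hh, _), inl TC
  | inr (Dh, _), inl TT | inr (Dh, _), inl TC => true
  | _, _ => false
  end.

(** The total weight of the routes defined below is 3 (k + 1), so unshared arcs never obstruct
    them. *)
Definition core_cap (u v : core) : nat :=
  if shared u v then 1%N else if unshared u v then (3 * k.+1)%N else 0%N.

Definition in_A (v : core) : nat := match v with inl SA => 1 | inl SR => k | _ => 0 end.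
Definition out_A (v : core) : nat := if v is inl TT then k.+1 else 0%N.
Definition in_B (v : core) : nat := match v with inr (SB, _) | inr (SC, _) => 1 | _ => 0 end.
(** The arcs leaving the [Bt] have total capacity k + 1, of which A takes one unit; a demand of k at
    [TB] makes B fill the rest. [TC] absorbs the remaining 2 (k + 1) - k units. *)
Definition out_B (v : core) : nat := match v with inl TB => k | inl TC => k.+2 | _ => 0 end.

Lemma sum_support (R : nmodType) (T : finType) (l : seq T) (F : T -> R) :
  uniq l -> (forall u, u \notin l -> F u = 0) -> \sum_u F u = \sum_(u <- l) F u.
Proof.
move=> ul F0; rewrite [RHS]big_uniq // [RHS]big_mkcond; apply: eq_bigr => u _.
by case: ifP => // /negbT/F0.
Qed.

Section CoreFlow.
Variables (R : realType) (f : core -> core -> R) (bi bo : core -> R).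
Hypotheses (f_ge0 : forall u v, 0 <= f u v)
  (f_supp : forall u v, ~~ shared u v -> ~~ unshared u v -> f u v = 0)
  (f_cons : forall v, bi v + \sum_u f u v = bo v + \sum_u f v u)
  (bi_inner : forall s i, s != SB -> s != SC -> bi (L s i) = 0)
  (bo_inner : forall s i, bo (L s i) = 0).

Lemma no_inflow v : bi v = 0 -> bo v = 0 -> (forall u, f u v = 0) -> forall u, f v u = 0.
Proof.
move=> i0 o0 f0 u; have := f_cons v; rewrite i0 o0 !add0r big1 // => /esym/eqP.
by rewrite psumr_eq0 // => /allP/(_ u (mem_index_enum _))/eqP.
Qed.

Lemma no_outflow v : bi v = 0 -> bo v = 0 -> (forall u, f v u = 0) -> forall u, f u v = 0.
Proof.
move=> i0 o0 f0 u; have := f_cons v; rewrite i0 o0 !add0r => /eqP; rewrite [X in _ == X]big1 //.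
by rewrite psumr_eq0 // => /allP/(_ u (mem_index_enum _))/eqP.
Qed.

Ltac support :=
  let u := fresh "u" in let nu := fresh "nu" in
  move=> u; rewrite !inE; case: u => [[]|[[] ?]] //= nu; apply: f_supp => //=;
  by apply: contra nu => /eqP -> ; rewrite eqxx ?orbT.

Ltac conserve v ins outs :=
  have := f_cons v; rewrite ?bo_inner;
  try (rewrite [bi _]bi_inner; [|by []|by []]); rewrite ?add0r;
  rewrite (@sum_support _ _ ins (fun u => f u v)) //; last (by support);
  rewrite (@sum_support _ _ outs (fun u => f v u)) //; last (by support);
  rewrite !big_cons !big_nil !addr0.

Lemma cons_Bt i : f (H SA) (L Bt i) + f (L SB i) (L Bt i) = f (L Bt i) (L Bh i).
Proof. by conserve (L Bt i) [:: H SA; L SB i] [:: L Bh i]. Qed.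

Lemma cons_Et i : f (H SR) (L Et i) + f (L SB i) (L Et i) = f (L Et i) (L Eh i).
Proof. by conserve (L Et i) [:: H SR; L SB i] [:: L Eh i]. Qed.

Lemma cons_Ht i : f (L SC i) (L Ht i) + f (L Eh i) (L Ht i) = f (L Ht i) (L Hh i).
Proof. by conserve (L Ht i) [:: L SC i; L Eh i] [:: L Hh i]. Qed.

Lemma cons_Bh i : f (L Bt i) (L Bh i) = f (L Bh i) (L Dt (ordS i)) + f (L Bh i) (H TB).
Proof. by conserve (L Bh i) [:: L Bt i] [:: L Dt (ordS i); H TB]. Qed.

Lemma cons_Eh i : f (L Et i) (L Eh i) = f (L Eh i) (L Ht i) + f (L Eh i) (H TC).
Proof. by conserve (L Eh i) [:: L Et i] [:: L Ht i; H TC]. Qed.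

Lemma cons_SB i : bi (L SB i) = f (L SB i) (L Bt i) + f (L SB i) (L Et i).
Proof. by conserve (L SB i) (Nil core) [:: L Bt i; L Et i]. Qed.

Lemma cons_SC i : bi (L SC i) = f (L SC i) (L Ht i) + f (L SC i) (L Dt i).
Proof. by conserve (L SC i) (Nil core) [:: L Ht i; L Dt i]. Qed.

Lemma cons_Dt i : f (L SC (ordS i)) (L Dt (ordS i)) + f (L Bh i) (L Dt (ordS i)) =
  f (L Dt (ordS i)) (L Dh (ordS i)).
Proof.
have := f_cons (L Dt (ordS i)); rewrite bo_inner bi_inner // !add0r.
rewrite (@sum_support _ _ [:: L SC (ordS i); L Bh i] (fun u => f u (L Dt (ordS i)))) //; last first.
  move=> u; rewrite !inE; case: u => [[]|[[] j]] //= nu; apply: f_supp => //=.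
    by apply: contra nu => /eqP ->; rewrite eqxx.
  by apply: contra nu => /eqP /ordS_inj ->; rewrite eqxx ?orbT.
rewrite (@sum_support _ _ [:: L Dh (ordS i)] (fun u => f (L Dt (ordS i)) u)) //; last by support.
by rewrite !big_cons !big_nil !addr0.
Qed.

Lemma sum_support_lane (s : stage) (F : core -> R) :
  (forall u, (forall i, u != L s i) -> F u = 0) -> \sum_u F u = \sum_i F (L s i).
Proof.
move=> F0; rewrite big_sumType /= big1 ?add0r; last by move=> h _; apply: F0.
rewrite (eq_bigr (fun p => F (L p.1 p.2))) => [|[]] //.
rewrite -(pair_bigA _ (fun s i => F (L s i))) (bigD1 s) //=.
rewrite [X in _ + X]big1 ?addr0 // => s' ss'; apply: big1 => i _; apply: F0 => j.
by apply: contra ss' => /eqP [->].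
Qed.

Lemma cons_SA : bi (H SA) = bo (H SA) + \sum_i f (H SA) (L Bt i).
Proof.
have := f_cons (H SA); rewrite [X in _ + X = _]big1 ?addr0 => [->|[[]|[[] ?]] _]; last first.
all: try exact: f_supp.
rewrite (@sum_support_lane Bt (fun u => f (H SA) u)) // => -[[]|[[] i]] nu; try exact: f_supp.
by have := nu i; rewrite eqxx.
Qed.

Lemma cons_SR : bi (H SR) = bo (H SR) + \sum_i f (H SR) (L Et i).
Proof.
have := f_cons (H SR); rewrite [X in _ + X = _]big1 ?addr0 => [->|[[]|[[] ?]] _]; last first.
all: try exact: f_supp.
rewrite (@sum_support_lane Et (fun u => f (H SR) u)) // => -[[]|[[] i]] nu; try exact: f_supp.
by have := nu i; rewrite eqxx.
Qed.

Lemma cons_TB : bi (H TB) + \sum_i f (L Bh i) (H TB) = bo (H TB).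
Proof.
have := f_cons (H TB); rewrite [X in _ = _ + X]big1 ?addr0 => [<-|[[]|[[] ?]] _]; last first.
all: try exact: f_supp.
rewrite (@sum_support_lane Bh (fun u => f u (H TB))) // => -[[]|[[] i]] nu; try exact: f_supp.
by have := nu i; rewrite eqxx.
Qed.

End CoreFlow.

Section TwoFlows.
Variables (R : realType) (a b : core -> core -> R) .
Hypotheses (a_ge0 : forall u v, 0 <= a u v) (b_ge0 : forall u v, 0 <= b u v)
  (cap : forall u v, a u v + b u v <= (core_cap u v)%:R)
  (a_cons : forall v, (in_A v)%:R + \sum_u a u v = (out_A v)%:R + \sum_u a v u)
  (b_cons : forall v, (in_B v)%:R + \sum_u b u v = (out_B v)%:R + \sum_u b v u).

Lemma core_forced i : a (H SA) (L Bt i) = k.+1%:R^-1.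
Proof.
have zero u v : ~~ shared u v -> ~~ unshared u v -> a u v = 0 /\ b u v = 0.
  move=> /negbTE s /negbTE n; have := cap u v; rewrite /core_cap s n.
  by have := a_ge0 u v; have := b_ge0 u v; split; lra.
have a0 u v : ~~ shared u v -> ~~ unshared u v -> a u v = 0 by move=> s /(zero _ _ s)[].
have b0 u v : ~~ shared u v -> ~~ unshared u v -> b u v = 0 by move=> s /(zero _ _ s)[].
have ai s j : s != SB -> s != SC -> (in_A (L s j))%:R = 0 :> R by [].
have ao s j : (out_A (L s j))%:R = 0 :> R by [].
have bi s j : s != SB -> s != SC -> (in_B (L s j))%:R = 0 :> R by case: s.
have bo s j : (out_B (L s j))%:R = 0 :> R by [].
have capS u v : shared u v -> a u v + b u v <= 1 by move=> s; have := cap u v; rewrite /core_cap s.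
have aSB j v : a (L SB j) v = 0.
  by apply: (no_inflow a_ge0 a_cons) => // -[[]|[[] ?]]; apply: a0.
have aSC j v : a (L SC j) v = 0.
  by apply: (no_inflow a_ge0 a_cons) => // -[[]|[[] ?]]; apply: a0.
have aTB u : a u (H TB) = 0.
  by apply: (no_outflow a_ge0 a_cons) => // -[[]|[[] ?]]; apply: a0.
have aTC u : a u (H TC) = 0.
  by apply: (no_outflow a_ge0 a_cons) => // -[[]|[[] ?]]; apply: a0.
have bSA v : b (H SA) v = 0.
  by apply: (no_inflow b_ge0 b_cons) => // -[[]|[[] ?]]; apply: b0.
have bSR v : b (H SR) v = 0.
  by apply: (no_inflow b_ge0 b_cons) => // -[[]|[[] ?]]; apply: b0.
pose z j := a (H SA) (L Bt j); pose q j := b (L SC j) (L Ht j); pose u j := b (L SB j) (L Bt j).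
have zE j : a (L Dt (ordS j)) (L Dh (ordS j)) = z j.
  rewrite -(cons_Dt a0 a_cons ai ao) aSC add0r.
  have := cons_Bh a0 a_cons ai ao j; rewrite aTB addr0 => <-.
  by rewrite -(cons_Bt a0 a_cons ai ao) aSB addr0.
have rE j : a (L Ht j) (L Hh j) = a (L Et j) (L Eh j).
  rewrite -(cons_Ht a0 a_cons ai ao) aSC add0r.
  by have := cons_Eh a0 a_cons ai ao j; rewrite aTC addr0 => <-.
have sz : \sum_j z j = 1.
  by have /esym := cons_SA a0 a_cons; rewrite /= add0r.
have sr : \sum_j a (L Et j) (L Eh j) = k%:R.
  have := cons_SR a0 a_cons; rewrite /= add0r => ->; apply: eq_bigr => j _.
  by rewrite -(cons_Et a0 a_cons ai ao) aSB addr0.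
have uE j : b (L Bt j) (L Bh j) = u j.
  by rewrite -(cons_Bt b0 b_cons bi bo) bSA add0r.
have eE j : b (L Et j) (L Eh j) = 1 - u j.
  rewrite -(cons_Et b0 b_cons bi bo) bSR add0r.
  by have := cons_SB b0 b_cons bo j; rewrite /= /u; lra.
have su : k%:R <= \sum_j u j.
  have := cons_TB b0 b_cons; rewrite /= add0r => <-; apply: ler_sum => j _.
  have := cons_Bh b0 b_cons bi bo j; rewrite uE => ->.
  by rewrite lerDr.
have hB j : z j + u j <= 1.
  have := capS (L Bt j) (L Bh j) (eqxx _); rewrite uE.
  by rewrite -(cons_Bt a0 a_cons ai ao) aSB addr0.
have szu : \sum_j (z j + u j) <= \sum_(j < k.+1) 1.
  by apply: ler_sum => j _.
(* The sums of z and u amount to at least 1 + k, the number of lanes, so all inequalities [hB] are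
   equalities. *)
have zu j : u j = 1 - z j.
  have : \sum_j (1 - (z j + u j)) == 0.
    rewrite sumrB subr_eq0; apply/eqP/le_anti; rewrite szu andbT.
    by rewrite big_split /= sz sumr_const card_ord -[_ *+ _]/(k.+1%:R) -natr1; lra.
  rewrite psumr_eq0 => [/allP/(_ j (mem_index_enum _))/= /eqP|l _]; first by lra.
  by rewrite subr_ge0.
have hE j : a (L Et j) (L Eh j) + (1 - u j) <= 1.
  by rewrite -eE; apply: capS; rewrite /= eqxx.
(* By [hE] the flow of A on this arc is at most [u j], and both sides sum to k. *)
have ru j : a (L Et j) (L Eh j) = 1 - z j.
  have : \sum_j (u j - a (L Et j) (L Eh j)) == 0.
    rewrite sumrB subr_eq0 sr; under eq_bigr do rewrite zu.
    by rewrite sumrB sz sumr_const card_ord -[_ *+ _]/(k.+1%:R) -natr1 addrK.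
  rewrite psumr_eq0 => [/allP/(_ j (mem_index_enum _))/= /eqP|l _]; first by rewrite zu; lra.
  by have := hE l; lra.
have hH j : q j <= z j.
  have := capS (L Ht j) (L Hh j) (eqxx _); rewrite rE ru.
  rewrite -(cons_Ht b0 b_cons bi bo) -/(q j).
  by have := b_ge0 (L Eh j) (L Ht j); lra.
have hD j : z j <= q (ordS j).
  have := capS (L Dt (ordS j)) (L Dh (ordS j)) (eqxx _); rewrite zE.
  rewrite -(cons_Dt b0 b_cons bi bo).
  have := cons_SC b0 b_cons bo (ordS j); rewrite /= -/(q _).
  by have := b_ge0 (L Bh j) (L Dt (ordS j)); lra.
have step j : z j <= z (ordS j) by apply: le_trans (hD j) (hH _).
(* [ordS] permutes the lanes, so the nonnegative increments of z sum to zero. *)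
have zS j : z (ordS j) = z j.
  have : \sum_j (z (ordS j) - z j) == 0.
    by rewrite sumrB subr_eq0 [X in _ == X](reindex_inj (@ordS_inj _)).
  rewrite psumr_eq0 => [/allP/(_ j (mem_index_enum _))/= |l _]; last by rewrite subr_ge0.
  by rewrite subr_eq0 => /eqP.
have z0 j : z j = z ord0.
  case: j => n; elim: n => [|n IHn] ltn; first by congr z; apply: val_inj.
  rewrite -(IHn (ltnW ltn)) -[RHS]zS; congr z; apply: val_inj.
  by rewrite /= modn_small.
move: sz; under eq_bigr do rewrite z0; rewrite sumr_const card_ord => E.
have -> : a (H SA) (L Bt i) = z ord0 by rewrite -(z0 i).
have k0 : k.+1%:R != 0 :> R by rewrite pnatr_eq0.
by apply: (mulIf k0); rewrite mulr_natr E mulVf.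
Qed.

End TwoFlows.

End Core.

(** * The fractional multiflow inside the core *)

Inductive route := RA | RR | RB | RE | RH | RD.

Definition route_code (x : route) : nat :=
  match x with RA => 0 | RR => 1 | RB => 2 | RE => 3 | RH => 4 | RD => 5 end.
Definition route_decode (n : nat) : option route :=
  nth None (map some [:: RA; RR; RB; RE; RH; RD]) n.
Lemma route_codeK : pcancel route_code route_decode. Proof. by case. Qed.
HB.instance Definition _ := Countable.copy route (pcan_type route_codeK).
Lemma route_enumP : Finite.axiom [:: RA; RR; RB; RE; RH; RD]. Proof. by case. Qed.
HB.instance Definition _ := isFinite.Build route route_enumP.

Lemma stage_eqE (s t : stage) : (s == t) = (stage_code s == stage_code t).
Proof. by case: s; case: t. Qed.

Lemma hub_eqE (s t : hub) : (s == t) = (hub_code s == hub_code t).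
Proof. by case: s; case: t. Qed.

Section Routes.
Variables (R : realType) (k : nat).
Local Notation lane := 'I_k.+1.
Local Notation core := (hub + stage * lane)%type.
Local Notation H h := (inl h : core).
Local Notation L s i := (inr (s, i) : core).

Definition route_path (p : route * lane) : seq core :=
  let i := p.2 in
  match p.1 with
  | RA => [:: H SA; L Bt i; L Bh i; L Dt (ordS i); L Dh (ordS i); H TT]
  | RR => [:: H SR; L Et i; L Eh i; L Ht i; L Hh i; H TT]
  | RB => [:: L SB i; L Bt i; L Bh i; H TB]
  | RE => [:: L SB i; L Et i; L Eh i; H TC]
  | RH => [:: L SC i; L Ht i; L Hh i; H TC]
  | RD => [:: L SC i; L Dt i; L Dh i; H TC]
  end.

Definition in_commodity_A (x : route) : bool :=
  match x with RA | RR => true | _ => false end.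

(** The values forced by z = 1 / (k + 1). On each shared arc one route of A meets one of B, with
    weights 1 / (k + 1) and k / (k + 1) in some order. *)
Definition route_weight (x : route) : R :=
  match x with
  | RA | RE | RH => k.+1%:R^-1
  | RR | RB | RD => k%:R / k.+1%:R
  end.

Lemma route_weight_ge0 x : 0 <= route_weight x.
Proof. by case: x; rewrite /= ?divr_ge0 ?invr_ge0 ?ler0n. Qed.

Lemma route_sum (F : route * lane -> R) :
  \sum_p F p = \sum_i F (RA, i) + \sum_i F (RR, i) + \sum_i F (RB, i) +
    \sum_i F (RE, i) + \sum_i F (RH, i) + \sum_i F (RD, i).
Proof.
rewrite (eq_bigr (fun p => F (p.1, p.2))) => [|[]] //.
rewrite -(pair_bigA _ (fun x i => F (x, i))) /=.
rewrite (@sum_support _ _ [:: RA; RR; RB; RE; RH; RD]) //; last by case.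
by rewrite !big_cons big_nil addr0 !addrA.
Qed.

Lemma core_eqE (u v : core) : (u == v) =
  match u, v with
  | inl h, inl h' => hub_code h == hub_code h'
  | inr p, inr q => (stage_code p.1 == stage_code q.1) && (p.2 == q.2)
  | _, _ => false
  end.
Proof. by case: u v => [h|[s i]] [h'|[s' i']] //=; rewrite -?hub_eqE -?stage_eqE. Qed.

Lemma sum_delta (c : R) (j : lane) : \sum_i c * (j == i)%:R = c.
Proof.
rewrite (bigD1 j) //= eqxx big1 ?mulr1 ?addr0 // => i /negbTE ij.
by rewrite eq_sym ij mulr0.
Qed.

Lemma sum_deltaS (c : R) (j : lane) : \sum_i c * (j == ordS i)%:R = c.
Proof. by rewrite -[RHS](sum_delta c j) [RHS](reindex_inj (@ordS_inj _)). Qed.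

Lemma sum_const (c : R) : \sum_(i < k.+1) c * true%:R = c * k.+1%:R.
Proof. by rewrite sumr_const card_ord mulr1 mulr_natr. Qed.

Lemma sum_false (c : R) : \sum_(i < k.+1) c * false%:R = 0.
Proof. by rewrite big1 // => i _; rewrite mulr0. Qed.

(** The weight of the routes through a vertex is an integer although the weights are not; this is
    why the spare capacities of the Eulerian completion can be natural numbers. *)
Definition visits (v : core) : nat :=
  match v with
  | inl SA => 1 | inl SR => k | inl TT => k.+1 | inl TB => k | inl TC => k.+2
  | inr _ => 1
  end.

Let K0 : k.+1%:R != 0 :> R. Proof. by rewrite pnatr_eq0. Qed.
Let KE : k.+1%:R = k%:R + 1 :> R. Proof. by rewrite natr1. Qed.
Let KKE : k.+2%:R = k%:R + 2 :> R. Proof. by rewrite -addn2 natrD. Qed.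
Let K0' : k%:R + 1 != 0 :> R. Proof. by rewrite -KE. Qed.

Lemma route_visits v :
  \sum_p route_weight p.1 * (v \in route_path p)%:R = (visits v)%:R.
Proof.
rewrite route_sum -!big_split /=; case: v => [[]|[[] j]].
all: under eq_bigr do rewrite !(inE, core_eqE) /= ?orbF.
all: rewrite !big_split /= ?sum_delta ?sum_deltaS ?sum_const ?sum_false ?KKE ?KE.
all: by field.
Qed.
Lemma route_start b v :
  \sum_p (if in_commodity_A p.1 == b then route_weight p.1 else 0) *
      (head (H SA) (route_path p) == v)%:R = (if b then in_A v else in_B v)%:R.
Proof.
rewrite route_sum -!big_split /=; case: b; case: v => [[]|[[] j]].
all: under eq_bigr do rewrite !core_eqE /= ?mul0r ?add0r ?addr0 1?(eq_sym _ j).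
all: rewrite ?big_split /= ?sum_delta ?sum_deltaS ?sum_const ?sum_false ?KKE ?KE ?addr0.
all: try (rewrite big1 //).
all: by field.
Qed.

Lemma route_end b v :
  \sum_p (if in_commodity_A p.1 == b then route_weight p.1 else 0) *
      (last (H SA) (route_path p) == v)%:R = (if b then out_A v else out_B v)%:R.
Proof.
rewrite route_sum -!big_split /=; case: b; case: v => [[]|[[] j]].
all: under eq_bigr do rewrite !core_eqE /= ?mul0r ?add0r ?addr0 1?(eq_sym _ j).
all: rewrite ?big_split /= ?sum_delta ?sum_deltaS ?sum_const ?sum_false ?KKE ?KE ?addr0.
all: try (rewrite big1 //).
all: by field.
Qed.

Lemma route_uniq p : uniq (route_path p).
Proof. by case: p => [[] i]. Qed.

Definition core_load (u v : core) : R :=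
  \sum_p route_weight p.1 * ((u, v) \in zip (route_path p) (behead (route_path p)))%:R.

Lemma core_load_ge0 u v : 0 <= core_load u v.
Proof. by apply: sumr_ge0 => p _; rewrite mulr_ge0 ?route_weight_ge0. Qed.

Lemma core_load_shared u v : shared u v -> core_load u v = 1.
Proof.
rewrite /core_load route_sum -!big_split /=.
case: u v => [[]|[[] i]] // [[]|[[] j]] //= /eqP <-.
all: under eq_bigr do rewrite !inE !xpair_eqE !core_eqE /= ?andbb ?orbF ?andbF ?orbF.
all: rewrite !big_split /= ?sum_delta ?sum_deltaS ?sum_const ?sum_false ?KE.
all: by field.
Qed.

Lemma route_arc p u v :
  (u, v) \in zip (route_path p) (behead (route_path p)) -> shared u v || unshared u v.
Proof.
case: p => -[] i; rewrite /= !inE; do ?[case/orP];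
  by move=> /eqP[-> ->]; rewrite /= ?eqxx.
Qed.

Lemma core_load_le u v : core_load u v <= (core_cap u v)%:R.
Proof.
rewrite /core_cap; case: ifP => [su|su]; first by rewrite core_load_shared.
case: ifP => [_|nu]; last first.
  rewrite /core_load big1 // => p _; case E: (_ \in _); last by rewrite mulr0.
  by have := route_arc E; rewrite su nu.
apply: le_trans (_ : \sum_(p : route * lane) route_weight p.1 * true%:R <= _).
  apply: ler_sum => p _; rewrite ler_wpM2l ?route_weight_ge0 //.
  by case: (_ \in _).
rewrite route_sum /= !sum_const natrM KE le_eqVlt; apply/orP; left; apply/eqP.
by field.
Qed.

Lemma core_load_out u :
  \sum_v core_load u v + (out_A u + out_B u)%:R = (visits u)%:R.
Proof.
rewrite natrD -(route_end true) -(route_end false) -route_visits /core_load.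
rewrite exchange_big -!big_split /=; apply: eq_bigr => p _.
have := route_uniq p; have : route_path p != [::] by case: p => [[] i].
case: (route_path p) => // x q _ uq; rewrite -mulr_sumr -natr_sum arcs_fst //=.
have -> (w : R) : (if in_commodity_A p.1 == true then w else 0) * (last x q == u)%:R +
    (if in_commodity_A p.1 == false then w else 0) * (last x q == u)%:R =
    w * (last x q == u)%:R.
  by case: in_commodity_A; rewrite /= mul0r ?add0r ?addr0.
rewrite -mulrDr -natrD; congr (_ * _%:R).
move: uq; rewrite lastI rcons_uniq mem_rcons inE => /andP[lq _].
by have [->|_] := eqVneq u (last x q); rewrite ?(negbTE lq) ?addn0.
Qed.

Lemma core_load_in v :
  \sum_u core_load u v + (in_A v + in_B v)%:R = (visits v)%:R.
Proof.
rewrite natrD -(route_start true) -(route_start false) -route_visits /core_load.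
rewrite exchange_big -!big_split /=; apply: eq_bigr => p _.
have := route_uniq p; have : route_path p != [::] by case: p => [[] i].
case: (route_path p) => // x q _ uq; rewrite -mulr_sumr -natr_sum arcs_snd //=.
have -> (w : R) : (if in_commodity_A p.1 == true then w else 0) * (x == v)%:R +
    (if in_commodity_A p.1 == false then w else 0) * (x == v)%:R = w * (x == v)%:R.
  by case: in_commodity_A; rewrite /= mul0r ?add0r ?addr0.
rewrite -mulrDr -natrD; congr (_ * _%:R); rewrite inE.
case/andP: uq => xq _.
by have [->|_] := eqVneq v x; rewrite ?(negbTE xq) ?addn0.
Qed.

End Routes.

(** * Assembling the network *)

Section FullPath.
Variables S W : finType.
Local Notation V := (S + W)%type.

Definition full_path (s t : S) (w : seq W) : seq V := inl s :: rcons (map inr w) (inl t).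

Definition full_arc (s t : S) (w : seq W) (x y : V) : bool :=
  (x, y) \in zip (full_path s t w) (behead (full_path s t w)).

Lemma arcs_full s t x q :
  zip (full_path s t (x :: q)) (behead (full_path s t (x :: q))) =
  (inl s, inr x) :: rcons [seq (inr a.1 : V, inr a.2 : V) | a <- zip (x :: q) q]
                          (inr (last x q), inl t).
Proof.
rewrite /full_path /=; congr cons; elim: q x => //= y q IHq x.
by rewrite IHq.
Qed.

Lemma full_arc_cc s t w u v :
  full_arc s t w (inr u) (inr v) =
  ((u, v) \in zip w (behead w)).
Proof.
rewrite /full_arc; case: w => [|x q]; first by rewrite /= inE.
have inj : injective (fun a : W * W => (inr a.1 : V, inr a.2 : V)) by move=> [? ?] [? ?] [-> ->].
rewrite arcs_full inE mem_rcons inE !xpair_eqE /= andbF.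
exact: (mem_map inj _ (u, v)).
Qed.

Lemma notin_core (l : seq (W * W)) (s : S) (y : V) :
  (((inl s, y) \in [seq (inr a.1 : V, inr a.2 : V) | a <- l]) = false) *
  (((y, inl s) \in [seq (inr a.1 : V, inr a.2 : V) | a <- l]) = false).
Proof. by split; apply/mapP=> -[a _ E]; case: E. Qed.

Lemma full_arc_sc s t w s' v :
  full_arc s t w (inl s') (inr v) =
  (s' == s) && (if w is x :: _ then x == v else false).
Proof.
rewrite /full_arc; case: w => [|x q]; first by rewrite /= inE xpair_eqE /= ?andbF.
by rewrite arcs_full inE mem_rcons inE notin_core !xpair_eqE /= ?andbF ?orbF (eq_sym x).
Qed.

Lemma full_arc_ct s t w t' v :
  full_arc s t w (inr v) (inl t') =
  (t' == t) && (if w is x :: q then last x q == v else false).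
Proof.
rewrite /full_arc; case: w => [|x q]; first by rewrite /= inE xpair_eqE /= ?andbF.
rewrite arcs_full inE mem_rcons inE notin_core !xpair_eqE /= ?andbF ?orbF.
by rewrite andbC (eq_sym (last _ _)).
Qed.

Lemma full_arc_st s t w s' t' :
  full_arc s t w (inl s') (inl t') =
  [&& s' == s, t' == t & nilp w].
Proof.
rewrite /full_arc; case: w => [|x q]; first by rewrite /= inE xpair_eqE andbT.
by rewrite arcs_full inE mem_rcons inE notin_core !xpair_eqE /= ?andbF ?orbF.
Qed.

Lemma full_path_joins (cp : V -> V -> nat) s t w : s != t -> uniq w ->
  joins (N := net cp) s t (full_path s t w).
Proof.
move=> st uw; rewrite /joins /full_path eqxx last_rcons eqxx /=.
apply/and3P; split; first by elim: (rcons _ _) (inl s : V) => //=.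
  rewrite mem_rcons inE negb_or; apply/andP; split; first by apply: contra st => /eqP[->].
  by apply/negP=> /mapP[].
rewrite rcons_uniq map_inj_uniq ?uw ?andbT => [|? ? []//].
by apply/negP=> /mapP[].
Qed.

End FullPath.

Section Saturating.
Variables (R : realType) (S W : finType) (mu : S -> S -> R).
Variable cp : S + W -> S + W -> nat.
Variables (c r : S -> R).
Local Notation V := (S + W)%type.

(** Converse direction of complementary slackness: tight end pairs make the value of the family its
    total path length, and saturation of the charged arcs makes that equal to [capacity_length]. *)
Lemma saturating_family (J : finType) (wt : J -> R) (src tgt : J -> S) (w : J -> seq W)
    (pa := fun j => full_path (src j) (tgt j) (w j))
    (fam := fun x y : V => \sum_j wt j * (full_arc (src j) (tgt j) (w j) x y)%:R)
    (P : {fset seq V}) (lam : seq V -> R) :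
    optimal_multiflow mu (N := net cp) P lam ->
    (forall j, 0 <= wt j) ->
    (forall j, wt j != 0 -> [/\ src j != tgt j, uniq (w j) &
       c (src j) + r (tgt j) = mu (src j) (tgt j)]) ->
    (forall x y : V, fam x y <= (cp x y)%:R) ->
    (forall x y : V, arc_length c r x y != 0 -> fam x y = (cp x y)%:R) ->
  capacity_length cp c r <= mu_value mu (N := net cp) P lam.
Proof.
move=> opt wt0 jn fle feq.
apply: le_trans (optimum_ge_family (src := src) (tgt := tgt) (pa := pa) opt wt0 _ fle); last first.
  by move=> j /jn[st uw _]; split=> //; apply: full_path_joins.
rewrite le_eqVlt; apply/orP; left; apply/eqP.
transitivity (\sum_x \sum_y fam x y * arc_length c r x y).
  apply: eq_bigr => x _; apply: eq_bigr => y _.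
  by have [->|/feq ->//] := eqVneq (arc_length c r x y) 0; rewrite !mulr0.
rewrite /fam; under eq_bigr => x _ do under eq_bigr => y _ do rewrite mulr_suml.
under eq_bigr => x _ do rewrite exchange_big.
rewrite exchange_big; apply: eq_bigr => j _.
have [->|/jn[st uw <-]] := eqVneq (wt j) 0.
  by rewrite mul0r big1 // => x _; rewrite big1 // => y _; rewrite !mul0r.
have uq : uniq (pa j) by have := full_path_joins cp st uw => /(joins_ends st)[].
transitivity (wt j * path_length c r (pa j)).
  rewrite /path_length.
  have <- := sum_mem (fun a => arc_length c r a.1 a.2) (uniq_arcs uq).
  rewrite pair_big /= mulr_sumr; apply: eq_bigr => -[x y] _ /=.
  by rewrite mulrA.
congr (_ * _); rewrite /pa /full_path path_length_joins big_map big1 ?addr0 //.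
by move=> i _; rewrite /= addr0.
Qed.

End Saturating.

Lemma not_integral (R : realType) (k : nat) : (0 < k)%N ->
  ~~ (k%:R * k.+1%:R^-1 \is a @Num.int R).
Proof.
move=> k0; apply/negP=> /intrP [z zE].
have K0 : 0 < k.+1%:R :> R by rewrite ltr0n.
have : 0 < (z%:~R : R) < 1.
  rewrite -zE; apply/andP; split; first by rewrite divr_gt0 ?ltr0n.
  by rewrite ltr_pdivrMr // mul1r ltr_nat.
by rewrite ltr0z ltrz1; lia.
Qed.

Section Assembly.
Variables (R : realType) (S : finType) (mu : S -> S -> R) (k : nat).
Variables (c r : S -> R) (s1 t1 s2 t2 s3 t3 : S) (third : bool) (dir : S -> S -> nat).
Local Notation lane := 'I_k.+1.
Local Notation core := (hub + stage * lane)%type.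
Local Notation V := (S + core)%type.

(* Capacities completing the core to an Eulerian network; the third commodity,
   present for totally Eulerian networks only, uses the capacity which the two
   others leave free. *)
Definition spare_out (v : core) : nat :=
  (third * (\sum_u core_cap v u + (out_A v + out_B v) - visits v))%N.
Definition spare_in (v : core) : nat :=
  (third * (\sum_u core_cap u v + (in_A v + in_B v) - visits v))%N.

(** The third commodity uses the free capacity of a core arc from u to v along s1, u, v, t1. Hence
    the arc from s1 to u gets the free capacity leaving u, and the arc from v to t1 gets the free
    capacity entering v. *)
Definition assembled_cap (x y : V) : nat :=
  match x, y with
  | inl s, inr v => ((s == s2) * in_A v + (s == s3) * in_B v + (s == s1) * spare_out v)%N
  | inr v, inl t => ((t == t2) * out_A v + (t == t3) * out_B v + (t == t1) * spare_in v)%N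
  | inl s, inl t => dir s t
  | inr u, inr v => core_cap u v
  end.

Hypotheses (mu_le : forall s t, mu s t <= c s + r t)
  (c_ge0 : forall s, 0 <= c s) (r_ge0 : forall s, 0 <= r s)
  (cr_gt0 : forall s, 0 < c s + r s) (mu_diag : forall s, mu s s = 0)
  (mu2 : 0 < mu s2 t2) (mu3 : 0 < mu s3 t3)
  (tight22 : c s2 + r t2 = mu s2 t2) (tight33 : c s3 + r t3 = mu s3 t3)
  (slack23 : c s2 + r t3 != mu s2 t3) (slack32 : c s3 + r t2 != mu s3 t2)
  (tight11 : third -> c s1 + r t1 = mu s1 t1)
  (slack1 : third -> [/\ c s1 + r t2 != mu s1 t2, c s1 + r t3 != mu s1 t3,
     c s2 + r t1 != mu s2 t1 & c s3 + r t1 != mu s3 t1])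
  (dir_tight : forall s t, (0 < dir s t)%N -> c s + r t = mu s t).

Lemma tight_neq s t : c s + r t = mu s t -> s != t.
Proof. by move=> st; apply/eqP=> E; have := cr_gt0 s; rewrite {2}E st E mu_diag ltxx. Qed.

Lemma sources_neq : s2 != s3. Proof. by apply: contra slack32 => /eqP <-; rewrite tight22. Qed.
Lemma sinks_neq : t2 != t3. Proof. by apply: contra slack23 => /eqP <-; rewrite tight22. Qed.

Lemma spare_out0 v : spare_out v != 0%N -> third.
Proof. by rewrite /spare_out; case: third. Qed.
Lemma spare_in0 v : spare_in v != 0%N -> third.
Proof. by rewrite /spare_in; case: third. Qed.

Lemma cap_s2 v : assembled_cap (inl s2) (inr v) = in_A v.
Proof.
rewrite /= eqxx (negbTE sources_neq) mul1n mul0n addn0.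
case: eqVneq => [E|_]; last by rewrite mul0n addn0.
have [->|/spare_out0 e] := eqVneq (spare_out v) 0%N; first by rewrite muln0 addn0.
by have [_ _ + _] := slack1 e; rewrite E tight11 ?eqxx.
Qed.

Lemma cap_s3 v : assembled_cap (inl s3) (inr v) = in_B v.
Proof.
rewrite /= eqxx (eq_sym s3) (negbTE sources_neq) mul1n mul0n add0n.
case: eqVneq => [E|_]; last by rewrite mul0n addn0.
have [->|/spare_out0 e] := eqVneq (spare_out v) 0%N; first by rewrite muln0 addn0.
by have [_ _ _] := slack1 e; rewrite E tight11 ?eqxx.
Qed.

Lemma cap_t2 v : assembled_cap (inr v) (inl t2) = out_A v.
Proof.
rewrite /= eqxx (negbTE sinks_neq) mul1n mul0n addn0.
case: eqVneq => [E|_]; last by rewrite mul0n addn0.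
have [->|/spare_in0 e] := eqVneq (spare_in v) 0%N; first by rewrite muln0 addn0.
by have [+ _ _ _] := slack1 e; rewrite E tight11 ?eqxx.
Qed.

Lemma cap_t3 v : assembled_cap (inr v) (inl t3) = out_B v.
Proof.
rewrite /= eqxx (eq_sym t3) (negbTE sinks_neq) mul1n mul0n add0n.
case: eqVneq => [E|_]; last by rewrite mul0n addn0.
have [->|/spare_in0 e] := eqVneq (spare_in v) 0%N; first by rewrite muln0 addn0.
by have [_ + _ _] := slack1 e; rewrite E tight11 ?eqxx.
Qed.

Lemma cap_src s v : (0 < assembled_cap (inl s) (inr v))%N ->
  (c s + r t2 = mu s t2 -> s = s2) /\ (c s + r t3 = mu s t3 -> s = s3).
Proof.
rewrite /=; case: (eqVneq s s2) => [-> _|_].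
  by split=> // E; move: slack23; rewrite E eqxx.
case: (eqVneq s s3) => [-> _|_].
  by split=> // E; move: slack32; rewrite E eqxx.
case: (eqVneq s s1) => // ->; rewrite !mul0n mul1n lt0n => /spare_out0 e.
by have [E1 E2 _ _] := slack1 e; split=> E; [move: E1 | move: E2]; rewrite E eqxx.
Qed.

Lemma cap_tgt t v : (0 < assembled_cap (inr v) (inl t))%N ->
  (c s2 + r t = mu s2 t -> t = t2) /\ (c s3 + r t = mu s3 t -> t = t3).
Proof.
rewrite /=; case: (eqVneq t t2) => [-> _|_].
  by split=> // E; move: slack32; rewrite E eqxx.
case: (eqVneq t t3) => [-> _|_].
  by split=> // E; move: slack23; rewrite E eqxx.
case: (eqVneq t t1) => // ->; rewrite !mul0n mul1n lt0n => /spare_in0 e.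
by have [_ _ E1 E2] := slack1 e; split=> E; [move: E1 | move: E2]; rewrite E eqxx.
Qed.

(** Each route contributes its weight once at its start and once at its end. *)
Lemma boundary_balance b :
  \sum_(v : core) (if b then in_A v else in_B v)%:R =
  \sum_(v : core) (if b then out_A v else out_B v)%:R :> R.
Proof.
under eq_bigr => v _ do rewrite -(route_start R b).
under [RHS]eq_bigr => v _ do rewrite -(route_end R b).
rewrite exchange_big [RHS]exchange_big; apply: eq_bigr => p _.
rewrite -!mulr_sumr -!natr_sum; congr (_ * _%:R).
have one (u : core) : (\sum_v (u == v) = 1)%N.
  by rewrite (bigD1 u) //= eqxx big1 // => v; rewrite eq_sym => /negbTE ->.
by rewrite !one.
Qed.

Section Forced.
Variables (P : {fset seq V}) (lam : seq V -> R).
Hypotheses (Pflow : multiflow (N := net assembled_cap) P lam)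
  (Pge : capacity_length assembled_cap c r <= mu_value mu (N := net assembled_cap) P lam).

Let Ptight := (tight_multiflow mu_le c_ge0 r_ge0 cr_gt0 Pflow Pge).1.
Let Psat := (tight_multiflow mu_le c_ge0 r_ge0 cr_gt0 Pflow Pge).2.

(** As [mu s0 t0 > 0], at least one of [c s0] and [r t0] is positive, and slackness saturates the
    arcs at that end. At the other end the loads are bounded by the capacities and have the same
    total. *)
Lemma saturated_commodity s0 t0 (I O : core -> nat) :
    0 < mu s0 t0 -> c s0 + r t0 = mu s0 t0 ->
    (forall v, assembled_cap (inl s0) (inr v) = I v) ->
    (forall v, assembled_cap (inr v) (inl t0) = O v) ->
    (forall u t, (0 < assembled_cap (inr u) (inl t))%N -> c s0 + r t = mu s0 t -> t = t0) ->
    (forall s u, (0 < assembled_cap (inl s) (inr u))%N -> c s + r t0 = mu s t0 -> s = s0) ->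
    \sum_v (I v)%:R = \sum_v (O v)%:R :> R ->
  forall v, flow assembled_cap P lam s0 t0 (inl s0) (inr v) = (I v)%:R /\
            flow assembled_cap P lam s0 t0 (inr v) (inl t0) = (O v)%:R.
Proof.
move=> mu0 tt IE OE Ht Hs IO; have st0 := tight_neq tt.
have fI v : flow assembled_cap P lam s0 t0 (inl s0) (inr v) = load assembled_cap P lam (inl s0) (inr v).
  exact: (flow_src_load Pflow Ptight).
have fO v : flow assembled_cap P lam s0 t0 (inr v) (inl t0) = load assembled_cap P lam (inr v) (inl t0).
  exact: (flow_tgt_load Pflow Ptight).
have leI v : flow assembled_cap P lam s0 t0 (inl s0) (inr v) <= (I v)%:R.
  by rewrite fI -IE; apply: load_le.
have leO v : flow assembled_cap P lam s0 t0 (inr v) (inl t0) <= (O v)%:R.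
  by rewrite fO -OE; apply: load_le.
have tot : \sum_v flow assembled_cap P lam s0 t0 (inl s0) (inr v) =
    \sum_v flow assembled_cap P lam s0 t0 (inr v) (inl t0).
  have : \sum_v (flow assembled_cap P lam s0 t0 (inl s0) (inr v) +
      \sum_u flow assembled_cap P lam s0 t0 (inr u) (inr v)) =
    \sum_v (flow assembled_cap P lam s0 t0 (inr v) (inl t0) +
      \sum_u flow assembled_cap P lam s0 t0 (inr v) (inr u)).
    by apply: eq_bigr => v _; apply: (flow_conserve_core Ptight).
  by rewrite !big_split /= [X in _ + X = _]exchange_big => /addIr.
have squeeze (f g : core -> R) : (forall v, f v <= g v) -> \sum_v f v = \sum_v g v ->
    forall v, f v = g v.
  move=> fg E v; have : \sum_v (g v - f v) == 0 by rewrite sumrB E subrr.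
  rewrite psumr_eq0 => [/allP/(_ v (mem_index_enum _))|u _]; last by rewrite subr_ge0.
  by rewrite /= subr_eq0 => /eqP.
have [c0|c0] := ltP 0 (c s0).
  have EI v : flow assembled_cap P lam s0 t0 (inl s0) (inr v) = (I v)%:R.
    by rewrite fI -IE; apply: Psat; rewrite /arc_length /= addr0.
  have EO := squeeze _ _ leO; move=> v; split=> //; apply: EO.
  by rewrite -tot -IO; apply: eq_bigr => u _.
have EO v : flow assembled_cap P lam s0 t0 (inr v) (inl t0) = (O v)%:R.
  by rewrite fO -OE; apply: Psat; rewrite /arc_length /= add0r; move: mu0; lra.
have EI := squeeze _ _ leI; move=> v; split=> //; apply: EI.
by rewrite tot IO; apply: eq_bigr => u _.
Qed.

Lemma not_fractionally_integral : (0 < k)%N ->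
  ~ fractionally_integral (N := net assembled_cap) k P lam.
Proof.
move=> k0 Pk.
have A := saturated_commodity mu2 tight22 cap_s2 cap_t2
  (fun u t H => (cap_tgt H).1) (fun s u H => (cap_src H).1) (boundary_balance true).
have B := saturated_commodity mu3 tight33 cap_s3 cap_t3
  (fun u t H => (cap_tgt H).2) (fun s u H => (cap_src H).2) (boundary_balance false).
pose a (u v : core) := flow assembled_cap P lam s2 t2 (inr u) (inr v).
pose b (u v : core) := flow assembled_cap P lam s3 t3 (inr u) (inr v).
have aE : a (inl SA) (inr (Bt, ord0)) = k.+1%:R^-1.
  apply: (@core_forced _ _ a b) => [u v|u v|u v|v|v].
  - exact: (flow_ge0 Pflow).
  - exact: (flow_ge0 Pflow).
  - exact: (flow_add_le Pflow _ _ _ _ sources_neq).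
  - have := flow_conserve_core Ptight v (tight_neq tight22).
    by have [-> ->] := A v.
  - have := flow_conserve_core Ptight v (tight_neq tight33).
    by have [-> ->] := B v.
have := flow_int s2 t2 (inr (inl SA)) (inr (inr (Bt, ord0))) Pk.
by rewrite -/(a _ _) aE (negbTE (not_integral _ k0)).
Qed.

End Forced.

Lemma spare_outE v : (spare_out v)%:R =
  third%:R * \sum_u ((core_cap v u)%:R - core_load R v u) :> R.
Proof.
have visE := core_load_out R v; have cap0 := fun u => core_load_le R v u.
rewrite /spare_out natrM; congr (_ * _); rewrite natrB ?natrD ?natr_sum.
  by rewrite sumrB -visE natrD; ring.
rewrite -(ler_nat R) natrD natr_sum -visE.
by rewrite lerD2r; apply: ler_sum => u _; apply: cap0.
Qed.

Lemma spare_inE v : (spare_in v)%:R =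
  third%:R * \sum_u ((core_cap u v)%:R - core_load R u v) :> R.
Proof.
have visE := core_load_in R v; have cap0 := fun u => core_load_le R u v.
rewrite /spare_in natrM; congr (_ * _); rewrite natrB ?natrD ?natr_sum.
  by rewrite sumrB -visE natrD; ring.
rewrite -(ler_nat R) natrD natr_sum -visE.
by rewrite lerD2r; apply: ler_sum => u _; apply: cap0.
Qed.

Let family : finType := ((route * lane) + ((core * core) + (S * S)))%type.

Definition family_weight (j : family) : R :=
  match j with
  | inl p => route_weight R k p.1
  | inr (inl uv) => third%:R * ((core_cap uv.1 uv.2)%:R - core_load R uv.1 uv.2)
  | inr (inr st) => (dir st.1 st.2)%:R
  end.

Definition family_src (j : family) : S :=
  match j with
  | inl p => if in_commodity_A p.1 then s2 else s3
  | inr (inl _) => s1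
  | inr (inr st) => st.1
  end.

Definition family_tgt (j : family) : S :=
  match j with
  | inl p => if in_commodity_A p.1 then t2 else t3
  | inr (inl _) => t1
  | inr (inr st) => st.2
  end.

Definition family_core (j : family) : seq core :=
  match j with
  | inl p => route_path p
  | inr (inl uv) => [:: uv.1; uv.2]
  | inr (inr _) => [::]
  end.

Lemma family_weight_ge0 j : 0 <= family_weight j.
Proof.
case: j => [p|[[u v]|st]] /=; first exact: route_weight_ge0.
- by rewrite mulr_ge0 // subr_ge0 core_load_le.
- exact: ler0n.
Qed.

Lemma family_ok j : family_weight j != 0 -> [/\ family_src j != family_tgt j,
  uniq (family_core j) & c (family_src j) + r (family_tgt j) = mu (family_src j) (family_tgt j)].
Proof.
case: j => [p|[[u v]|[s t]]] /= w0.
- split; [|exact: route_uniq|by case: ifP].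
  by case: ifP => _; apply: tight_neq.
- have e : third by move: w0; case: third; rewrite ?mul0r ?eqxx.
  split; [exact: tight_neq (tight11 e)| |exact: tight11].
  (* The core has no capacity from a vertex to itself, so the sequence u, u has weight zero. *)
  rewrite inE andbT; apply: contra w0 => /eqP <-.
  have cap0 : core_cap u u = 0%N by case: (u) => [[]|[[] i]].
  have := core_load_le R u u; have := core_load_ge0 R u u; rewrite cap0 => h1 h2.
  by rewrite (_ : core_load R u u = 0) ?subrr ?mulr0 //; apply/le_anti; rewrite h1 h2.
- have d0 : (0 < dir s t)%N by rewrite lt0n; apply: contra w0 => /eqP ->.
  by split=> //; [exact: tight_neq (dir_tight d0) | exact: dir_tight].
Qed.

(** The family of routes, spare paths and direct arcs fills every arc that touches a terminal. Arcs
    inside the core have length zero, and on them a bound by the capacity is enough. *)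
Lemma optimum_capacity_length (P : {fset seq V}) (lam : seq V -> R) :
  optimal_multiflow mu (N := net assembled_cap) P lam ->
  capacity_length assembled_cap c r <= mu_value mu (N := net assembled_cap) P lam.
Proof.
move=> opt; pose fam (x y : V) := \sum_j family_weight j *
  (full_arc (family_src j) (family_tgt j) (family_core j) x y)%:R.
have famE (x y : V) : fam x y =
    \sum_p route_weight R k p.1 *
      (full_arc (family_src (inl p)) (family_tgt (inl p)) (route_path p) x y)%:R +
    (\sum_u \sum_v third%:R * ((core_cap u v)%:R - core_load R u v) *
       (full_arc s1 t1 [:: u; v] x y)%:R +
     \sum_s \sum_t (dir s t)%:R * (full_arc s t ([::] : seq core) x y)%:R).
  by rewrite !pair_bigA /fam big_sumType [X in _ + X = _]big_sumType.
have zero2 (I J : finType) (F : I -> J -> R) : (forall i j, F i j = 0) -> \sum_i \sum_j F i j = 0.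
  by move=> F0; rewrite big1 // => i _; rewrite big1.
have fam_cc u v : fam (inr u) (inr v) = core_load R u v +
    third%:R * ((core_cap u v)%:R - core_load R u v).
  rewrite famE; under eq_bigr => p _ do rewrite full_arc_cc.
  rewrite [X in _ + (_ + X)]zero2 ?addr0 => [|s t]; last by rewrite full_arc_cc mulr0.
  congr (_ + _); rewrite (bigD1 u) //= (bigD1 v) //= full_arc_cc /= inE eqxx mulr1.
  rewrite !big1 ?addr0 // => [u' u'u|v' v'v].
    rewrite big1 // => v' _; rewrite full_arc_cc /= inE xpair_eqE.
    by rewrite eq_sym (negbTE u'u) mulr0.
  by rewrite full_arc_cc /= inE xpair_eqE [v == v']eq_sym (negbTE v'v) andbF mulr0.
have fam_sc s v : fam (inl s) (inr v) = (assembled_cap (inl s) (inr v))%:R.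
  rewrite famE [X in _ + (_ + X)]zero2 ?addr0 => [|s' t']; last first.
    by rewrite full_arc_sc andbF mulr0.
  rewrite /=; move: (spare_outE v); move: (spare_out v) => n nE.
  rewrite !natrD !natrM {}nE; congr (_ + _); last first.
    rewrite (bigD1 v) //= [X in _ + X]big1 ?addr0 => [|u uv].
      rewrite !mulr_sumr; apply: eq_bigr => u _; rewrite full_arc_sc eqxx andbT.
      by rewrite mulrC mulrA.
    by rewrite big1 // => u' _; rewrite full_arc_sc (negbTE uv) andbF mulr0.
  rewrite -(route_start R true v) -(route_start R false v) !mulr_sumr -big_split /=.
  apply: eq_bigr => p _; rewrite full_arc_sc.
  have -> : (if route_path p is x :: _ then x == v else false) = (head (inl SA) (route_path p) == v).
    by case: p => [[] i].
  case: in_commodity_A; rewrite /= ?mul0r ?mulr0 ?addr0 ?add0r;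
    by case: (s == _); case: (_ == v); rewrite /= ?mul0r ?mulr0 ?mul1r ?mulr1.
have fam_ct t v : fam (inr v) (inl t) = (assembled_cap (inr v) (inl t))%:R.
  rewrite famE [X in _ + (_ + X)]zero2 ?addr0 => [|s' t']; last first.
    by rewrite full_arc_ct andbF mulr0.
  rewrite /=; move: (spare_inE v); move: (spare_in v) => n nE.
  rewrite !natrD !natrM {}nE; congr (_ + _); last first.
    rewrite exchange_big (bigD1 v) //= [X in _ + X]big1 ?addr0 => [|u uv].
      rewrite !mulr_sumr; apply: eq_bigr => u _; rewrite full_arc_ct /= eqxx andbT.
      by rewrite mulrC mulrA.
    by rewrite big1 // => u' _; rewrite full_arc_ct /= (negbTE uv) andbF mulr0.
  rewrite -(route_end R true v) -(route_end R false v) !mulr_sumr -big_split /=.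
  apply: eq_bigr => p _; rewrite full_arc_ct.
  have -> : (if route_path p is x :: q then last x q == v else false) =
      (last (inl SA) (route_path p) == v).
    by case: p => [[] i].
  case: in_commodity_A; rewrite /= ?mul0r ?mulr0 ?addr0 ?add0r;
    by case: (t == _); case: (_ == v); rewrite /= ?mul0r ?mulr0 ?mul1r ?mulr1.
have fam_st s t : fam (inl s) (inl t) = (assembled_cap (inl s) (inl t))%:R.
  rewrite famE big1 ?add0r => [|p _]; last first.
    by rewrite full_arc_st (_ : nilp _ = false) ?andbF ?mulr0 //; case: p => [[] i].
  rewrite zero2 ?add0r => [|u v]; last by rewrite full_arc_st !andbF mulr0.
  rewrite (bigD1 s) //= (bigD1 t) //= full_arc_st !eqxx mulr1.
  rewrite !big1 ?addr0 // => [s' s's|t' t't].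
    by rewrite big1 // => t' _; rewrite full_arc_st eq_sym (negbTE s's) mulr0.
  by rewrite full_arc_st [t == t']eq_sym (negbTE t't) andbF mulr0.
apply: (saturating_family opt family_weight_ge0 family_ok).
  move=> [s|u] [t|v]; rewrite -/(fam _ _) ?fam_st ?fam_sc ?fam_ct // fam_cc /=.
  have h := core_load_le R u v.
  by case: third; rewrite /= ?mul1r ?mul0r ?addr0 // addrC subrK.
move=> [s|u] [t|v] nz; rewrite -/(fam _ _) ?fam_st ?fam_sc ?fam_ct //.
by rewrite /arc_length /= addr0 eqxx in nz.
Qed.

Lemma assembled_no_optimum : (0 < k)%N -> ~ has_integral_optimum mu (net assembled_cap) k.
Proof.
move=> k0 [P [lam [opt Pk]]].
by apply: not_fractionally_integral Pk => //; [case: opt | apply: optimum_capacity_length].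
Qed.

End Assembly.

(** * Balancing the terminals *)

Section Eulerian.
Variables (R : realType) (S : finType) (k : nat).
Variables (s1 t1 s2 t2 s3 t3 : S) (w : S -> S -> nat).
Local Notation lane := 'I_k.+1.
Local Notation core := (hub + stage * lane)%type.
Hypotheses (w_balanced : balanced w)
  (w1 : (0 < w s1 t1)%N) (w2 : (0 < w s2 t2)%N) (w3 : (0 < w s3 t3)%N).

Let m1 := (\sum_(v : core) spare_out true v)%N.
Let m2 := (\sum_(v : core) in_A v)%N.
Let m3 := (\sum_(v : core) in_B v)%N.

(** Seen from the terminals, a commodity crossing the core acts as a bundle of direct arcs. Together
    with [direct_cap] it makes up a multiple of the balanced [w]. *)
Definition routed (s t : S) : nat :=
  ((s == s1) * (t == t1) * m1 + (s == s2) * (t == t2) * m2 + (s == s3) * (t == t3) * m3)%N.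

(* The multiple of the circulation is so large that the subtraction is exact. *)
Definition direct_cap (s t : S) : nat := ((m1 + m2 + m3) * w s t - routed s t)%N.

Lemma routed_le s t : (routed s t <= (m1 + m2 + m3) * w s t)%N.
Proof.
have le1 : (routed s t <= m1 + m2 + m3)%N.
  have le_m (a b : bool) n : (a * b * n <= n)%N by case: a b => [] []; rewrite ?mul1n ?mul0n.
  by rewrite /routed !leq_add.
case: (posnP (w s t)) => [w0|w0]; last by apply: leq_trans le1 _; rewrite leq_pmulr.
rewrite /routed w0 muln0.
have no a b : (0 < w a b)%N -> ((s == a) * (t == b) = 0)%N.
  by case: eqVneq => // <-; case: eqVneq => // <-; rewrite w0.
by rewrite !no // !mul0n.
Qed.

Lemma direct_cap_gt0 s t : (0 < direct_cap s t)%N -> (0 < w s t)%N.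
Proof. by rewrite /direct_cap; case: (w s t) => //; rewrite muln0 sub0n. Qed.

Lemma spare_total : m1 = (\sum_(v : core) spare_in true v)%N.
Proof.
apply/eqP; rewrite -(eqr_nat R) !natr_sum; apply/eqP.
under eq_bigr do rewrite spare_outE mul1r; under [RHS]eq_bigr do rewrite spare_inE mul1r.
exact: exchange_big.
Qed.

Lemma in_A_total : m2 = (\sum_(v : core) out_A v)%N.
Proof. by apply/eqP; rewrite -(eqr_nat R) !natr_sum; apply/eqP/(boundary_balance R k true). Qed.

Lemma in_B_total : m3 = (\sum_(v : core) out_B v)%N.
Proof. by apply/eqP; rewrite -(eqr_nat R) !natr_sum; apply/eqP/(boundary_balance R k false). Qed.

Lemma sum_pick (a : S) (n : nat) : (\sum_t (t == a) * n = n)%N.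
Proof. by rewrite (bigD1 a) //= eqxx mul1n big1 ?addn0 // => t /negbTE ->. Qed.

Lemma direct_cap_out s : (\sum_t direct_cap s t + ((s == s1) * m1 + (s == s2) * m2 + (s == s3) * m3) =
  (m1 + m2 + m3) * \sum_t w s t)%N.
Proof.
have -> : ((s == s1) * m1 + (s == s2) * m2 + (s == s3) * m3 = \sum_t routed s t)%N.
  rewrite /routed !big_split /=; congr (_ + _ + _)%N;
    by under eq_bigr do rewrite mulnAC mulnC; rewrite sum_pick.
rewrite -big_split big_distrr /=; apply: eq_bigr => t _.
by rewrite subnK ?routed_le.
Qed.

Lemma direct_cap_in t : (\sum_s direct_cap s t + ((t == t1) * m1 + (t == t2) * m2 + (t == t3) * m3) =
  (m1 + m2 + m3) * \sum_s w s t)%N.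
Proof.
have -> : ((t == t1) * m1 + (t == t2) * m2 + (t == t3) * m3 = \sum_s routed s t)%N.
  rewrite /routed !big_split /=; congr (_ + _ + _)%N;
    by under eq_bigr do rewrite -mulnA; rewrite sum_pick.
rewrite -big_split big_distrr /=; apply: eq_bigr => s _.
by rewrite subnK ?routed_le.
Qed.

Lemma visits_le_out v : (visits v <= \sum_u core_cap (k := k) v u + (out_A v + out_B v))%N.
Proof.
rewrite -(ler_nat R) natrD natr_sum -(core_load_out R v) lerD2r.
by apply: ler_sum => u _; apply: core_load_le.
Qed.

Lemma visits_le_in v : (visits v <= \sum_u core_cap (k := k) u v + (in_A v + in_B v))%N.
Proof.
rewrite -(ler_nat R) natrD natr_sum -(core_load_in R v) lerD2r.
by apply: ler_sum => u _; apply: core_load_le.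
Qed.

(** At a core vertex either total equals all core capacity at the vertex plus its supplies and
    demands minus [visits]; this expression is symmetric in entering and leaving arcs. *)
Lemma assembled_eulerian :
  totally_eulerian (net (assembled_cap (k := k) s1 t1 s2 t2 s3 t3 true direct_cap)).
Proof.
case=> [s|v]; rewrite [LHS]big_sumType [RHS]big_sumType /=.
  have D (b : bool) (f : core -> nat) : (\sum_v b * f v = b * \sum_v f v)%N.
    by rewrite big_distrr.
  rewrite !big_split /= (D _ (@in_A k)) (D _ (@in_B k)) (D _ (@out_A k)) (D _ (@out_B k)).
  rewrite (D _ (spare_out true)) (D _ (spare_in true)) -/m1 -/m2 -/m3.
  rewrite -spare_total -in_A_total -in_B_total.
  have := direct_cap_out s; have := direct_cap_in s; rewrite -w_balanced.
  by move=> <-; lia.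
rewrite !big_split /= !sum_pick /spare_out /spare_in !mul1n.
have := visits_le_out v; have := visits_le_in v.
by set a := (\sum_u core_cap u v)%N; set b := (\sum_u core_cap v u)%N; lia.
Qed.

End Eulerian.

(* Two tight pairs of value zero have all four potentials zero, so that the cross
   pairs are tight as well. *)
Lemma two_positive (R : realType) (S : finType) (mu : S -> S -> R) (c r : S -> R)
    (x y : 'I_3 -> S) :
    (forall s t, 0 <= mu s t) -> (forall s t, mu s t <= c s + r t) ->
    (forall s, 0 <= c s) -> (forall s, 0 <= r s) ->
    (forall i j, (c (x i) + r (y j) == mu (x i) (y j)) = (i == j)) ->
  exists i1 i2 i3, [/\ i1 != i2, i1 != i3, i2 != i3, 0 < mu (x i2) (y i2) & 0 < mu (x i3) (y i3)].
Proof.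
move=> mu0 mu_le c0 r0 tE.
have one i j : i != j -> mu (x i) (y i) = 0 -> 0 < mu (x j) (y j).
  move=> ij zi; rewrite lt_neqAle mu0 andbT eq_sym; apply: contra ij => /eqP zj.
  have /eqP := tE i i; rewrite eqxx => /eqP; have /eqP := tE j j; rewrite eqxx => /eqP.
  rewrite zi zj => /eqP ej /eqP ei; rewrite -tE eq_le mu_le andbT.
  have := mu0 (x i) (y j); have := c0 (x i); have := c0 (x j); have := r0 (y i).
  have := r0 (y j); lra.
have [i1 oth] : exists i1, forall j, i1 != j -> 0 < mu (x j) (y j).
  have [i /eqP zi|nz] := pickP (fun i => mu (x i) (y i) == 0); first by exists i => j /one; apply.
  by exists ord0 => j _; rewrite lt_neqAle mu0 andbT eq_sym nz.
have [d1 d2 d3] : [/\ i1 != ordS i1, i1 != ordS (ordS i1) & ordS i1 != ordS (ordS i1)].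
  by case: i1 {oth} => [[|[|[]]]].
by exists i1, (ordS i1), (ordS (ordS i1)); split=> //; apply: oth.
Qed.

Theorem theorem4p1 (R : realType) (S : finType) (mu : S -> S -> R)
    (hmu : directed_distance mu) :
  ((2 <= dim_Tmu mu)%N ->
     ~ exists k : nat, (0 < k)%N /\
         forall N : network S, has_integral_optimum mu N k) /\
  ((2 <= dim_Qslim_bar mu)%N ->
     ~ exists k : nat, (0 < k)%N /\
         forall N : network S, totally_eulerian N -> has_integral_optimum mu N k).
Proof.
have [mu0 mud] := hmu; split.
  move=> /Tmu_certificate [c [r [x [y [mu_le cr0 cr mup tE]]]]] [k [k0 opt]].
  have tt i : c (x i) + r (y i) = mu (x i) (y i) by apply/eqP; rewrite tE.
  (* The first pair is a placeholder: with [third] false its capacities vanish. *)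
  apply: (@assembled_no_optimum R S mu k c r (x true) (y true) (x true) (y true)
    (x false) (y false) false (fun _ _ => 0%N)) (opt _) => //.
  - by move=> s; have [] := cr0 s.
  - by move=> s; have [] := cr0 s.
  - by rewrite tE.
  - by rewrite tE.
move=> /(slim_certificate hmu) [c [r [x [y [w [[mu_le c0 r0 cr] tE wt wb wp]]]]]] [k [k0 opt]].
have tt i : c (x i) + r (y i) = mu (x i) (y i) by apply/eqP; rewrite tE.
(* If one of the three pairs has value zero, it becomes the third commodity. *)
have [i1 [i2 [i3 [i12 i13 i23 mu2 mu3]]]] := two_positive mu0 mu_le c0 r0 tE.
have nt i j : i != j -> c (x i) + r (y j) != mu (x i) (y j) by rewrite tE.
have eul := @assembled_eulerian R S k _ _ _ _ _ _ w wb (wp i1) (wp i2) (wp i3).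
apply: (@assembled_no_optimum R S mu k c r) (opt _ eul) => //.
- exact: nt.
- by apply: nt; rewrite eq_sym.
- by split; apply: nt => //; rewrite eq_sym.
- by move=> s t /direct_cap_gt0 /wt.
Qed.
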